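(* Let $\mathbf M=(M_1,M_2)$ be a two-step flag matroid on $[n]$ of rank $(r_1,r_2)$, and let $p\mathcal B(\mathbf M)$ be the set of subsets $S\subseteq[n]$ that are spanning in $M_1$ and independent in $M_2$. With $q$ a formal variable, \[ K\mathcal T^T_{\mathbf M}(1+q^{-1},1+q)=q^{-r_2}\Big(\prod_{i=1}^n(1+t_iq)\Big)\Big(\sum_{S\in p\mathcal B(\mathbf M)}\mathbf t^{\mathbf e_S}q^{|S|}\Big), \] and in particular $K\mathcal T_{\mathbf M}(1+q^{-1},1+q)=q^{-r_2}(1+q)^n\sum_{S\in p\mathcal B(\mathbf M)}q^{|S|}$, $K\mathcal T^T_{\mathbf M}(2,2)=\big(\prod_{i=1}^n(1+t_i)\big)\big(\sum_{S\in p\mathcal B(\mathbf M)}\mathbf t^{\mathbf e_S}\big)$, and $K\mathcal T_{\mathbf M}(2,2)=2^n|p\mathcal B(\mathbf M)|$.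
   Context: A two-step flag matroid is a pair $(M_1,M_2)$ of matroids on $[n]$ with $\operatorname{rk}_{M_2}(B)-\operatorname{rk}_{M_2}(A)\ge\operatorname{rk}_{M_1}(B)-\operatorname{rk}_{M_1}(A)$ for all $A\subseteq B\subseteq[n]$. Its bases are pairs $\mathbf B=(B_1\subseteq B_2)$ with $B_i$ a basis of $M_i$; $\mathbf e_S=\sum_{i\in S}\mathbf e_i$; $Q(\mathbf M)=\operatorname{Conv}\{\mathbf e_{B_1}+\mathbf e_{B_2}\}$; $\operatorname{Cone}_{\mathbf B}(\mathbf M)$ is the cone generated by $Q(\mathbf M)-\mathbf e_{B_1}-\mathbf e_{B_2}$, and $\operatorname{Hilb}(\operatorname{Cone}_{\mathbf B}(\mathbf M))\in\mathbb Q(t_1,\dots,t_n)$ is the multigraded Hilbert series of $\mathbb C[\mathbf t^\lambda:\lambda\in\operatorname{Cone}_{\mathbf B}(\mathbf M)\cap\mathbb Z^n]$. The equivariant flag-geometric Tutte polynomial is $K\mathcal T^T_{\mathbf M}(u+1,v+1):=\sum_{p,q}\chi^T\big(y(\mathbf M)^T[\mathcal O(1,1)]^T[\bigwedge^p\mathcal S_2]^T[\bigwedge^q\mathcal Q_1^\vee]^T\big)u^pv^q$, computed on the flag variety $Fl(r_1,r_2;n)$ with torus $T=(\mathbb C^* )^n$ acting by $t\cdot x=(t_i^{-1}x_i)$, where $\mathcal S_i$ are tautological subbundles, $\mathcal Q_i=\mathbb C^n/\mathcal S_i$, $\mathcal O(1,1)=\det\mathcal S_1^\vee\otimes\det\mathcal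 S_2^\vee$, $\chi^T$ is the equivariant Euler characteristic, and $y(\mathbf M)^T$ is the equivariant $K$-class whose restriction to the fixed point $x_{\mathbf S}$ (coordinate flag for $\mathbf S=(S_1\subseteq S_2)$) is $\operatorname{Hilb}(\operatorname{Cone}_{\mathbf S}(\mathbf M))\prod_{(i,j)\in Ex(\mathbf S)}(1-t_i^{-1}t_j)$ if $\mathbf S$ is a basis and $0$ otherwise, with $Ex(\mathbf S)=\{(i,j):i\in S_\ell, j\notin S_\ell\text{ for some }\ell\}$. Equivalently (by localization), $K\mathcal T^T_{\mathbf M}(u+1,v+1)=\sum_{\mathbf B}\operatorname{Hilb}(\operatorname{Cone}_{\mathbf B}(\mathbf M))\sum_{\mathfrak p\subseteq B_2}\sum_{\mathfrak q\subseteq[n]\setminus B_1}\mathbf t^{\mathbf e_{B_1}+\mathbf e_{\mathfrak p}+\mathbf e_{\mathfrak q}}u^{r_2-|\mathfrak p|}v^{|\mathfrak q|}$, a Laurent polynomial. The (non-equivariant) flag-geometric Tutte polynomial $K\mathcal T_{\mathbf M}(x,y)$ is obtained from $K\mathcal T^T_{\mathbf M}(x,y)$ by setting all $t_i=1$.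
   Formalization: In the first two identities the prefactor q^{-r_2} is corrected to q^{-(r_1+r_2)}; as printed they fail whenever r_1>0, e.g. n=1, M_1=M_2=U_{1,1}, where the left side is q^{-1}t_1(1+t_1q) but the printed right side is (1+t_1q)t_1. *)

(* Defs.v *)
From HB Require Import structures.
From mathcomp Require Import all_boot all_order all_algebra.
From mathcomp Require Import fraction polyXY.
From mathcomp.multinomials Require Import mpoly.
From Stdlib Require Import ClassicalEpsilon.

Set Implicit Arguments.
Unset Strict Implicit.
Unset Printing Implicit Defensive.

Import GRing.Theory Num.Theory.

Local Open Scope ring_scope.

Local Notation "x %:F" := (tofrac x) : ring_scope.

Record matroid (n : nat) := Matroid {
  indep : {set {set 'I_n}};
  indep0 : set0 \in indep;
  indepS : forall A B : {set 'I_n}, A \subset B -> B \in indep -> A \in indep;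
  indep_aug : forall A B : {set 'I_n}, A \in indep -> B \in indep ->
    (#|A| < #|B|)%N -> exists2 x, x \in B :\: A & x |: A \in indep
}.

Section MatroidDefs.
Variables (n : nat) (M : matroid n).

Definition rk (A : {set 'I_n}) : nat :=
  \max_(I in indep M | I \subset A) #|I|.

Definition is_basis (B : {set 'I_n}) : bool :=
  maxset (fun I => I \in indep M) B.

Definition spanning (S : {set 'I_n}) : bool := rk S == rk [set: 'I_n].

End MatroidDefs.

(* The natural-number subtractions below are not truncated, because
   A \subset B and rk is monotone. *)
Record flag_matroid (n : nat) := FlagMatroid {
  fm1 : matroid n;
  fm2 : matroid n;
  fm_quot : forall A B : {set 'I_n}, A \subset B ->
    (rk fm1 B - rk fm1 A <= rk fm2 B - rk fm2 A)%N
}.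

Definition set_flag (n : nat) := ({set 'I_n} * {set 'I_n})%type.

Definition flag_bases (n : nat) (M : flag_matroid n) : {set set_flag n} :=
  [set B : set_flag n | [&& is_basis (fm1 M) B.1, is_basis (fm2 M) B.2 & B.1 \subset B.2]].

Definition pseudo_bases (n : nat) (M : flag_matroid n) : {set {set 'I_n}} :=
  [set S | spanning (fm1 M) S && (S \in indep (fm2 M))].

(* R plays the role of the field of real numbers. *)
Section Convexity.
Variables (R : realFieldType) (n : nat).
Implicit Types (A : 'rV[R]_n -> Prop).

Definition conv_hull A (v : 'rV[R]_n) : Prop :=
  exists s : seq (R * 'rV[R]_n),
    [/\ forall x, x \in s -> 0 <= x.1 /\ A x.2,
        \sum_(x <- s) x.1 = 1 & v = \sum_(x <- s) x.1 *: x.2].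

Definition conic_hull A (v : 'rV[R]_n) : Prop :=
  exists s : seq (R * 'rV[R]_n),
    (forall x, x \in s -> 0 <= x.1 /\ A x.2) /\
    v = \sum_(x <- s) x.1 *: x.2.

Definition evec (S : {set 'I_n}) : 'rV[R]_n := \row_i (i \in S)%:R.

Variable M : flag_matroid n.

Definition base_polytope : 'rV[R]_n -> Prop :=
  conv_hull (fun v => exists2 B, B \in flag_bases M & v = evec B.1 + evec B.2).

Definition tangent_cone (B : set_flag n) : 'rV[R]_n -> Prop :=
  conic_hull (fun v => base_polytope (v + evec B.1 + evec B.2)).

End Convexity.

Definition ratfun (n : nat) := {fraction {mpoly rat[n]}}.

Definition tvar (n : nat) (i : 'I_n) : ratfun n := ('X_i : {mpoly rat[n]})%:F.

Definition tmon (n : nat) (w : 'rV[int]_n) : ratfun n :=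
  \prod_(i < n) tvar i ^ w 0 i.

Definition tset (n : nat) (S : {set 'I_n}) : ratfun n := \prod_(i in S) tvar i.

(* The Hilbert series of C[t^w : w in C and w integral] is the formal series
   \sum_w t^w, whose support need not lie in an orthant.  The formal series
   supported on Z^n form a module over the polynomial ring, and the series is
   the rational function N / D when D * (\sum_w t^w) = N for some polynomials
   D != 0 and N; hilbert_spec_unique shows that this determines N / D. *)
Section Hilbert.
Variables (R : realFieldType) (n : nat).

Definition zmon (m : 'X_{1..n}) : 'rV[int]_n := \row_i (m i)%:Z.

Definition zcoef (N : {mpoly rat[n]}) (w : 'rV[int]_n) : rat :=
  \sum_(m <- msupp N | zmon m == w) N@_m.

Definition mul_series (D : {mpoly rat[n]}) (s : 'rV[int]_n -> rat)
    (w : 'rV[int]_n) : rat :=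
  \sum_(m <- msupp D) D@_m * s (w - zmon m).

Definition hilbert_fun (C : 'rV[R]_n -> Prop) (w : 'rV[int]_n) : rat :=
  if excluded_middle_informative (C (map_mx intr w)) then 1 else 0.

Definition hilbert_spec (C : 'rV[R]_n -> Prop) (f : ratfun n) : Prop :=
  exists D N : {mpoly rat[n]},
    [/\ D != 0, mul_series D (hilbert_fun C) =1 zcoef N & f = N%:F / D%:F].

Definition hilb (C : 'rV[R]_n -> Prop) : ratfun n :=
  epsilon (inhabits 0) (hilbert_spec C).

Lemma mcoeffM_zcoef (D N : {mpoly rat[n]}) (m : 'X_{1..n}) :
  (D * N)@_m = mul_series D (zcoef N) (zmon m).
Proof.
rewrite /mul_series {1}(mpolyE D) mulr_suml raddf_sum /=; apply: eq_bigr => a _.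
rewrite -scalerAl mcoeffZ; congr (_ * _).
rewrite {1}(mpolyE N) mulr_sumr raddf_sum /= /zcoef [RHS]big_mkcond /=.
apply: eq_bigr => b _; rewrite -scalerAr mcoeffZ -mpolyXD mcoeffX.
suff -> : ((a + b)%MM == m) = (zmon b == zmon m - zmon a).
  by case: eqP => _; rewrite ?mulr1 ?mulr0.
apply/eqP/eqP => [<-|/rowP e].
  by apply/rowP => i; rewrite !mxE mnmDE PoszD addrAC subrr add0r.
apply/mnmP => i; rewrite mnmDE; have := e i; rewrite !mxE => /eqP.
by rewrite eq_sym subr_eq addrC -PoszD => /eqP [->].
Qed.

Lemma hilbert_spec_unique (C : 'rV[R]_n -> Prop) (f g : ratfun n) :
  hilbert_spec C f -> hilbert_spec C g -> f = g.
Proof.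
move=> [D1 [N1 [D1n0 e1 ->]]] [D2 [N2 [D2n0 e2 ->]]].
suff e : N1 * D2 = N2 * D1.
  apply/eqP; rewrite eqr_div ?tofrac_eq0 //.
  by rewrite -!tofracM e.
rewrite ![_ * D2]mulrC ![_ * D1]mulrC; apply/mpolyP => m.
rewrite !mcoeffM_zcoef /mul_series.
under eq_bigr => a _ do rewrite -e1 /mul_series mulr_sumr.
under [RHS]eq_bigr => a _ do rewrite -e2 /mul_series mulr_sumr.
rewrite exchange_big /=; apply: eq_bigr => a _; apply: eq_bigr => b _.
by rewrite mulrCA addrAC.
Qed.

End Hilbert.

(* A finite-dimensional representation of T = (C^* )^n is given by the list of
   its weights, with multiplicity. *)
Section TorusRep.
Variable n : nat.

Definition trep := seq 'rV[int]_n.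

Implicit Types V W : trep.

Definition rep_dual V : trep := [seq - w | w <- V].

Definition rep_tensor V W : trep := [seq v + w | v <- V, w <- W].

Definition rep_ext (p : nat) V : trep :=
  [seq \sum_(k in A) V`_k
     | A : {set 'I_(size V)} <- enum [set A : {set 'I_(size V)} | #|A| == p]].

Definition rep_det V : trep := rep_ext (size V) V.

Definition rep_char V : ratfun n := \sum_(w <- V) tmon w.

(* The coordinate subspace C^A of C^n: as t acts by (t_i^-1 x_i), the weight
   of the i-th basis vector is - e_i. *)
Definition rep_coord (A : {set 'I_n}) : trep :=
  [seq - delta_mx 0 i | i <- enum A].

End TorusRep.

(* Equivariant K-theory of Fl(r1, r2; n) in its localized description: the
   fixed points are the coordinate flags, a class is identified with the family
   of its restrictions to them, a vector bundle restricts to the character of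
   its fibre, and the equivariant Euler characteristic is computed by the
   localization formula; the cotangent weights at S are t_i^-1 t_j for (i, j)
   in Ex S. *)
Section KTheory.
Variables (n r1 r2 : nat).

Definition coord_flags : {set set_flag n} :=
  [set S : set_flag n | [&& #|S.1| == r1, #|S.2| == r2 & S.1 \subset S.2]].

Definition Ex (S : set_flag n) : {set 'I_n * 'I_n} :=
  [set ij : 'I_n * 'I_n | (ij.1 \in S.1) && (ij.2 \notin S.1)
         || (ij.1 \in S.2) && (ij.2 \notin S.2)].

Definition cotangent_euler (S : set_flag n) : ratfun n :=
  \prod_(ij in Ex S) (1 - (tvar ij.1)^-1 * tvar ij.2).

Definition Kclass := set_flag n -> ratfun n.

Definition chiT (a : Kclass) : ratfun n :=
  \sum_(S in coord_flags) a S / cotangent_euler S.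

Definition bundle := set_flag n -> trep n.

Definition bundle_class (E : bundle) : Kclass := fun S => rep_char (E S).

Definition taut1 : bundle := fun S => rep_coord S.1.
Definition taut2 : bundle := fun S => rep_coord S.2.
Definition quot1 : bundle := fun S => rep_coord (~: S.1).

Definition O11 : bundle := fun S =>
  rep_tensor (rep_dual (rep_det (taut1 S))) (rep_dual (rep_det (taut2 S))).
Definition ext_taut2 (p : nat) : bundle := fun S => rep_ext p (taut2 S).
Definition ext_quot1_dual (q : nat) : bundle :=
  fun S => rep_ext q (rep_dual (quot1 S)).

End KTheory.

Section FlagTutte.
Variables (R : realFieldType) (n : nat) (M : flag_matroid n).

Local Notation r1 := (rk (fm1 M) [set: 'I_n]).
Local Notation r2 := (rk (fm2 M) [set: 'I_n]).

Definition yclass : Kclass n := fun S =>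
  if S \in flag_bases M then hilb (tangent_cone (R := R) M S) * cotangent_euler S
  else 0.

Definition KT_coef (p q : nat) : ratfun n :=
  chiT r1 r2 (fun S => yclass S * bundle_class (@O11 n) S
                     * bundle_class (ext_taut2 (n := n) p) S
                     * bundle_class (ext_quot1_dual (n := n) q) S).

(* Polynomials in (x, y) = ('X, 'Y), following the convention of p.[x, y];
   the formal variables u, v of the definition are x - 1 and y - 1. *)
Definition KT_T : {poly {poly (ratfun n)}} :=
  \sum_(p < r2.+1) \sum_(q < (n - r1).+1)
    (KT_coef p q)%:P%:P * ('X - 1) ^+ p * ('Y - 1) ^+ q.

End FlagTutte.

(* The value at t_1 = ... = t_n = 1 of a rational function regular there, in
   particular of a Laurent polynomial. *)
Section AtOne.
Variable n : nat.

Definition at_one_spec (f : ratfun n) (c : rat) : Prop :=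
  exists N D : {mpoly rat[n]},
    [/\ D.@[fun=> 1] != 0, f = N%:F / D%:F & c = N.@[fun=> 1] / D.@[fun=> 1]].

Definition at_one (f : ratfun n) : rat := epsilon (inhabits 0) (at_one_spec f).

Lemma at_one_spec_unique (f : ratfun n) (c d : rat) :
  at_one_spec f c -> at_one_spec f d -> c = d.
Proof.
move=> [N1 [D1 [D1n0 -> ->]]] [N2 [D2 [D2n0 e ->]]].
have nz (D : {mpoly rat[n]}) : D.@[fun=> 1] != 0 -> D%:F != 0.
  by rewrite tofrac_eq0; apply: contraNneq => ->; rewrite meval0.
move/eqP: e; rewrite eqr_div ?nz // -!tofracM tofrac_eq => /eqP e.
by apply/eqP; rewrite eqr_div // -!mevalM e.
Qed.

End AtOne.

Definition KT (R : realFieldType) (n : nat) (M : flag_matroid n) :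
    {poly {poly rat}} :=
  map_poly (map_poly (@at_one n)) (KT_T R M).

Definition const_q (F : fieldType) : F -> {fraction {poly F}} :=
  @tofrac {poly F} \o polyC.

Definition qvar (F : fieldType) : {fraction {poly F}} := ('X : {poly F})%:F.

Definition eval_q (F : fieldType) (P : {poly {poly F}})
    (x y : {fraction {poly F}}) : {fraction {poly F}} :=
  (map_poly (map_poly (@const_q F)) P).[x, y].

(* Main.v *)
From HB Require Import structures.
Require Import Defs.
From mathcomp Require Import all_boot all_order all_algebra.
From mathcomp Require Import fraction polyXY ring zify.
From mathcomp.multinomials Require Import mpoly.
From Stdlib Require Import ClassicalEpsilon.

(* For a total order w of [n], write B(w) for the flag of greedy bases and
   H_w = prod_k 1 / (1 - t_{w(k+1)} / t_{w(k)}) for the Hilbert series of the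
   cone spanned by the differences e_{w(k+1)} - e_{w(k)}. Splitting the tangent
   cone at B along hyperplanes, modulo cones containing a line (whose series sum
   to 0), gives Hilb(Cone_B) = sum_{B(w) = B} H_w. The sums over w are evaluated
   by inserting the elements of [n] one at a time: for the other elements in a
   fixed order, the sum over the positions of k telescopes, because inserting k
   between x and y multiplies H by G(x) - G(y) with G(x) = t_x / (t_x - t_k).
   On the weight t^{B_1} prod_{B_2 - B_1} (1 + q t_i) this step is a
   deletion-contraction recursion, which produces the sum over pseudo-bases. On
   any polynomial weight satisfying the congruences modulo t_x - t_y for adjacent
   transpositions it preserves these congruences, so that each coefficient of the
   Tutte polynomial is a polynomial and may be evaluated at t = 1. *)

Import Order.TTheory GRing.Theory Num.Theory.
Local Open Scope ring_scope.

(** * Greedy bases *)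

(** The obstacle is the point t = 1: the series H_w have poles along t_x = t_y, so a sum over orders
    cannot be specialized term by term. The identity is therefore proved for generic t and q,
    cleared of denominators into an equality of polynomials in q over the ring of polynomials in t,
    and mapped from there to any field. The equality in q alone controls only the sums of the
    coefficients of u^p v^k with k - p fixed; that each coefficient is a polynomial in t needs the
    separate argument by congruences. The factor q^(-r1-r2) has two sources. Substituting u = q^-1
    in the product of u + t_i over B_2 gives q^(-r2). The elements of B_1 have weight t_i, whereas
    each element of a pseudo-basis has weight q t_i, and this gives q^(-r1). The second source is
    already visible for n = 1 with both matroids free: the value is t (q^-1 + t) = q^-2 (1 + t q) t
    q. *)

Section Rank.
Context {n : nat}.
Implicit Types (M : matroid n) (A B I J : {set 'I_n}) (x y : 'I_n) (w : seq 'I_n).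

Lemma rk_indep M I A : I \in indep M -> I \subset A -> (#|I| <= rk M A)%N.
Proof. by move=> hI hA; apply: (leq_bigmax_cond (P := fun J => (J \in indep M) && (J \subset A))); rewrite hI. Qed.

Lemma rk_ex M A : exists2 I, I \in indep M & I \subset A /\ #|I| = rk M A.
Proof.
have h0 : (0 < #|[pred I | (I \in indep M) && (I \subset A)]|)%N.
  by apply/card_gt0P; exists set0; rewrite inE indep0 sub0set.
have [I /andP[hI hA] e] := eq_bigmax_cond (fun I : {set 'I_n} => #|I|) h0.
by exists I.
Qed.

Lemma setU1_id x A : x \in A -> x |: A = A.
Proof. by move=> xA; apply/setUidPr; rewrite sub1set. Qed.

Lemma rkS M A B : A \subset B -> (rk M A <= rk M B)%N.
Proof.
move=> AB; have [I hI [IA <-]] := rk_ex M A.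
by apply: rk_indep => //; apply: subset_trans AB.
Qed.

Lemma rkU1 M x A : (rk M (x |: A) <= (rk M A).+1)%N.
Proof.
have [I hI [IA <-]] := rk_ex M (x |: A).
rewrite (cardsD1 x) -add1n leq_add ?leq_b1 // rk_indep //.
  by apply: indepS hI; rewrite subD1set.
by rewrite subDset.
Qed.

Lemma indep_extend M A J : J \in indep M -> J \subset A ->
  exists J', [/\ J' \in indep M, J \subset J', J' \subset A & #|J'| = rk M A].
Proof.
move=> hJ JA.
have [J' /maxsetP [/andP[hJ' J'A] mJ'] JJ'] :=
  @maxset_exists _ (fun I => (I \in indep M) && (I \subset A)) J (introT andP (conj hJ JA)).
exists J'; split=> //; apply/eqP; rewrite eqn_leq rk_indep //= leqNgt.
apply/negP => lt; have [I hI [IA eI]] := rk_ex M A.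
rewrite -eI in lt; have [x /setDP[xI xJ'] hx] := indep_aug hJ' hI lt.
have := mJ' (x |: J'); rewrite hx subUset sub1set (subsetP IA) // J'A => /(_ isT (subsetU1 _ _)) e.
by case/negP: xJ'; rewrite -e setU11.
Qed.

Lemma rk_indepE M A : (A \in indep M) = (rk M A == #|A|).
Proof.
apply/idP/eqP => [hA|e].
  have [I hI [IA e]] := rk_ex M A; apply/eqP.
  by rewrite eqn_leq rk_indep // andbT -e subset_leq_card.
have [I hI [IA eI]] := rk_ex M A.
suff -> : A = I by [].
by apply/esym/eqP; rewrite eqEcard IA eI e leqnn.
Qed.

(** Extend a basis of [A] to one of [y |: A], then to one of [x |: (y |: A)]. If the last step
    gained an element, it would be [x], and [x] together with the basis of [A] would be too large
    for the rank of [x |: A]. *)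
Lemma rk_cond M A x y : rk M (x |: A) = rk M A -> rk M (x |: (y |: A)) = rk M (y |: A).
Proof.
move=> e; apply/eqP; rewrite eqn_leq (rkS _ _ _ (subsetU1 _ _)) andbT leqNgt; apply/negP => lt.
have [J hJ [JA eJ]] := rk_ex M A.
have [J1 [hJ1 JJ1 J1A eJ1]] := indep_extend M (y |: A) J hJ (subset_trans JA (subsetU1 _ _)).
have [J2 [hJ2 JJ2 J2A eJ2]] :=
  indep_extend M (x |: (y |: A)) J1 hJ1 (subset_trans J1A (subsetU1 _ _)).
have xJ2 : x \in J2.
  apply/negPn/negP => xJ2.
  have : J2 \subset y |: A.
    apply/subsetP => z zJ; move/subsetP/(_ z zJ): J2A; rewrite in_setU1 => /orP[/eqP ez|//].
    by rewrite -ez zJ in xJ2.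
  by move/(rk_indep M J2 _ hJ2); rewrite eJ2 leqNgt lt.
have xA : x \notin y |: A.
  by apply: contraL lt => xA; rewrite (setU1_id x) ?ltnn.
have xJ : x \notin J.
  by apply: contra xA => /(subsetP JA) xA; rewrite in_setU1 xA orbT.
have : (#|x |: J| <= rk M (x |: A))%N.
  apply: rk_indep; last by rewrite setUS.
  by apply: indepS hJ2; rewrite subUset sub1set xJ2 (subset_trans JJ1).
by rewrite cardsU1 xJ e eJ add1n ltnn.
Qed.

Lemma basisE M B : is_basis M B = (B \in indep M) && (#|B| == rk M [set: 'I_n]).
Proof.
apply/idP/andP => [/maxsetP [hB mB]|[hB /eqP e]].
  split=> //; have [J [hJ BJ _ <-]] := indep_extend M setT B hB (subsetT _).
  by rewrite (mB J).
apply/maxsetP; split=> // J hJ BJ; apply/esym/eqP.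
by rewrite eqEcard BJ e rk_indep.
Qed.

(** [A] collects all the elements read so far, kept or not; the result is a basis of [w] in the
    contraction of [M] by [A]. *)
Fixpoint greedy M A w : {set 'I_n} :=
  if w is x :: w' then
    if (rk M A < rk M (x |: A))%N then x |: greedy M (x |: A) w' else greedy M (x |: A) w'
  else set0.

Lemma greedy_sub M A w : {subset greedy M A w <= w}.
Proof.
elim: w A => [|x w IH] A z /=; first by rewrite inE.
case: ifP => _; rewrite ?in_setU1 in_cons; last by move/IH ->; rewrite orbT.
by case/orP => [->//|/IH ->]; rewrite orbT.
Qed.

Lemma set_cons_swap x A w :
  (x |: A) :|: [set y in w] = A :|: [set y in x :: w].
Proof. by apply/setP => z; rewrite !inE orbA [(z \in A) || _]orbC. Qed.

(** When [x] raises the rank, a maximum independent extension of [J] inside [x |: A] can only be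
    [x |: J], and this is the basis handed to the induction. *)
Lemma greedy_indep M A w J : J \in indep M -> J \subset A -> #|J| = rk M A ->
  [/\ J :|: greedy M A w \in indep M & #|J :|: greedy M A w| = rk M (A :|: [set y in w])].
Proof.
elim: w A J => [|x w IH] A J hJ JA eJ /=.
  by rewrite setU0 hJ eJ set_nil setU0.
rewrite -set_cons_swap.
case: ifP => lt; last first.
  apply: IH => //; first exact: subset_trans JA (subsetU1 _ _).
  apply/eqP; rewrite eqn_leq eJ rkS ?subsetU1 //=; by rewrite leqNgt lt.
have [J' [hJ' JJ' J'A eJ']] := indep_extend M (x |: A) J hJ (subset_trans JA (subsetU1 _ _)).
have e' : rk M (x |: A) = (rk M A).+1 by apply/eqP; rewrite eqn_leq rkU1.
have xA : x \notin A.
  by apply: contraL lt => xA; rewrite (setU1_id x) ?ltnn.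
have xJ : x \notin J by apply: contra xA => /(subsetP JA).
have EJ : J' = x |: J.
  apply/eqP; rewrite eq_sym eqEcard cardsU1 xJ eJ' e' eJ add1n leqnn andbT.
  rewrite subUset sub1set JJ' andbT; apply/negPn/negP => xJ'.
  have : J' \subset A.
    apply/subsetP => z zJ; move/subsetP/(_ z zJ): J'A; rewrite in_setU1 => /orP[/eqP ez|//].
    by rewrite -ez zJ in xJ'.
  by move/(rk_indep M J' _ hJ'); rewrite eJ' e' ltnn.
have := IH (x |: A) J' hJ' J'A eJ'.
by rewrite EJ setUA [J :|: [set x]]setUC.
Qed.

Lemma rk0 M : rk M set0 = 0%N.
Proof.
have [I _ [+ <-]] := rk_ex M set0.
by rewrite subset0 => /eqP ->; rewrite cards0.
Qed.

Lemma greedy0_indep M w : greedy M set0 w \in indep M.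
Proof.
have [] := greedy_indep M set0 w set0 (indep0 M) (subxx _).
  by rewrite rk0 cards0.
by rewrite set0U.
Qed.

Lemma card_greedy0 M w : #|greedy M set0 w| = rk M [set y in w].
Proof.
have [] := greedy_indep M set0 w set0 (indep0 M) (subxx _).
  by rewrite rk0 cards0.
by rewrite !set0U.
Qed.

Lemma greedy_basis M w : (forall i, i \in w) -> is_basis M (greedy M set0 w).
Proof.
move=> hw; rewrite basisE greedy0_indep card_greedy0 /=; apply/eqP; congr rk.
by apply/setP => i; rewrite !inE hw.
Qed.

Lemma greedy_cat M A l r :
  greedy M A (l ++ r) = greedy M A l :|: greedy M (A :|: [set y in l]) r.
Proof.
elim: l A => [|x l IH] A /=; first by rewrite set_nil set0U setU0.
by rewrite IH set_cons_swap; case: ifP; rewrite ?setUA.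
Qed.

Lemma greedy_prefix M l r : uniq (l ++ r) ->
  greedy M set0 (l ++ r) :&: [set y in l] = greedy M set0 l.
Proof.
rewrite cat_uniq => /and3P[_ /hasPn h _]; rewrite greedy_cat setIUl.
rewrite (setIidPl _); last by apply/subsetP => z /greedy_sub; rewrite inE.
rewrite (_ : greedy _ _ r :&: _ = set0) ?setU0 //; apply/setP => z; rewrite !inE.
by apply/negbTE/negP => /andP[/greedy_sub/h/negP].
Qed.

(** This dominance on initial segments is what places the tangent cone at a greedy flag inside the
    cone of the chain. *)
Lemma greedy_dom M l r I : uniq (l ++ r) -> I \in indep M ->
  (#|I :&: [set y in l]| <= #|greedy M set0 (l ++ r) :&: [set y in l]|)%N.
Proof.
move=> u hI; rewrite greedy_prefix // card_greedy0 rk_indep ?subsetIr //.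
by apply: indepS hI; rewrite subsetIl.
Qed.

End Rank.

(** * The flag of greedy bases of an order *)

Section FlagRank.
Context {n : nat} (M : flag_matroid n).
Implicit Types (A : {set 'I_n}) (x : 'I_n) (w : seq 'I_n).

Lemma flag_jump A x :
  (rk (fm1 M) A < rk (fm1 M) (x |: A))%N -> (rk (fm2 M) A < rk (fm2 M) (x |: A))%N.
Proof.
move=> lt; have := fm_quot M (subsetU1 x A).
by rewrite -[in X in _ -> X]subn_gt0; apply: leq_trans; rewrite subn_gt0.
Qed.

(** The quotient condition, applied to adding one element, says that whatever is kept for the first
    matroid is kept for the second. *)
Lemma greedy_flag A w : greedy (fm1 M) A w \subset greedy (fm2 M) A w.
Proof.
elim: w A => [|x w IH] A //=.
case: ifP => [/flag_jump -> | _]; first by rewrite setUS.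
by case: ifP => _ //; apply: subset_trans (subsetU1 _ _).
Qed.

Definition gflag w : set_flag n := (greedy (fm1 M) set0 w, greedy (fm2 M) set0 w).

Lemma gflag_basis w : (forall i, i \in w) -> gflag w \in flag_bases M.
Proof. by move=> hw; rewrite inE !greedy_basis // greedy_flag. Qed.

End FlagRank.

(** * Sums over orders *)

Section Orders.
Context {T : eqType}.
Implicit Types (w s : seq T) (x : T).

Fixpoint inserts x w : seq (seq T) :=
  if w is y :: w' then (x :: w) :: map (cons y) (inserts x w') else [:: [:: x]].

(** The head of [s] is inserted last, so that a sum over orders is an outer sum over the orders of
    the tail and an inner sum over the positions of the head. *)
Fixpoint orders s : seq (seq T) :=
  if s is x :: s' then flatten (map (inserts x) (orders s')) else [:: [::]].

Lemma inserts_perm x w v : v \in inserts x w -> perm_eq v (x :: w).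
Proof.
elim: w v => [|y w IH] v /=; first by rewrite inE => /eqP ->.
rewrite inE => /orP[/eqP -> //|/mapP[v' /IH h ->]].
rewrite -(perm_cons y) in h; apply: perm_trans h _.
exact/permPl/(perm_catCA [:: y] [:: x] w).
Qed.

Lemma orders_perm s w : w \in orders s -> perm_eq w s.
Proof.
elim: s w => [|x s IH] w /=; first by rewrite inE => /eqP ->.
move=> /flatten_mapP[w' /IH h /inserts_perm h']; apply: perm_trans h' _.
by rewrite perm_cons.
Qed.

Lemma big_orders_cons (V : nmodType) (F : seq T -> V) x s :
  \sum_(w <- orders (x :: s)) F w = \sum_(w' <- orders s) \sum_(w <- inserts x w') F w.
Proof. by rewrite /= big_flatten big_map. Qed.

End Orders.

Section Chain.
Context {I : eqType} {F : fieldType} (t : I -> F).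
Context (tI : injective t).
Implicit Types (w : seq I) (f : seq I -> F).

(* The Hilbert series of the cone generated by the differences of consecutive
   unit vectors along w. *)
Fixpoint chain_series w : F :=
  if w is x :: w' then
    (if w' is y :: _ then t x / (t x - t y) else 1) * chain_series w'
  else 1.

(** What summation by parts leaves: the sum over [x] in [w] of G x times the change of [f] when [n]
    moves from just before [x] to just after it. The part of [w] already passed is absorbed into
    [f]. *)
Fixpoint tel n f w : F :=
  if w is x :: w' then
    t x / (t x - t n) * (f [:: x, n & w'] - f [:: n, x & w'])
      + tel n (fun v => f (x :: v)) w'
  else 0.

Lemma tel_scale n (c : F) f w : tel n (fun v => c * f v) w = c * tel n f w.
Proof.
elim: w f => [|x w IH] f /=; first by rewrite mulr0.
rewrite (IH (fun v => f (x :: v))); ring.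
Qed.

Lemma eq_tel n f g w : (forall v, f v = g v) -> tel n f w = tel n g w.
Proof.
elim: w f g => [|x w IH] f g e //=.
by rewrite !e (IH _ (fun v => g (x :: v))).
Qed.

Lemma diff_neq0 x y : x != y -> t x - t y != 0.
Proof. by rewrite subr_eq0 (inj_eq tI). Qed.

(* Summation by parts: inserting n between x and y multiplies the series of the
   chain by G x - G y, where G x = t x / (t x - t n). *)
Lemma inserts_sum_after p n f w : uniq (p :: w) -> n \notin p :: w ->
  \sum_(v <- inserts n w) chain_series (p :: v) * f v =
  chain_series (p :: w) * (t p / (t p - t n) * f (n :: w) + tel n f w).
Proof.
elim: w p f => [|x w IH] p f; first by move=> *; rewrite /= big_seq1 /=; ring.
rewrite [uniq _]/= !in_cons !negb_or => /and3P[/andP[px pw] xw uw] /and3P[np nx nw].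
rewrite [inserts _ _]/= big_cons big_map.
have -> : \sum_(v <- inserts n w) chain_series [:: p, x & v] * f (x :: v) =
    t p / (t p - t x) * \sum_(v <- inserts n w) chain_series (x :: v) * f (x :: v).
  by rewrite big_distrr; apply: eq_bigr => v _; rewrite /= -!mulrA.
rewrite (IH x (fun v => f (x :: v))) ?in_cons ?negb_or ?nx //= ?xw //.
have h1 := diff_neq0 _ _ px; have h2 : t p - t n != 0 by rewrite diff_neq0 // eq_sym.
have h3 := diff_neq0 _ _ nx; have h4 : t x - t n != 0 by rewrite diff_neq0 // eq_sym.
move: (chain_series w) (tel _ _ _) (match w with nil => _ | _ => _ end) => a b c.
field; by rewrite h1 h2 h3 h4.
Qed.

(** A missing left neighbour counts as G = 1, because 1 - G x = t_n / (t_n - t_x) is the factor of a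
    first step from [n] to [x]. *)
Lemma inserts_sum n f w : uniq w -> n \notin w ->
  \sum_(v <- inserts n w) chain_series v * f v =
  chain_series w * (f (n :: w) + tel n f w).
Proof.
case: w => [|x w]; first by move=> *; rewrite /= big_seq1 /=; ring.
move=> uw nw; rewrite [inserts _ _]/= big_cons big_map.
rewrite (inserts_sum_after x n (fun v => f (x :: v)) w) //=.
move: nw; rewrite in_cons negb_or => /andP[nx _].
have h3 := diff_neq0 _ _ nx; have h4 : t x - t n != 0 by rewrite diff_neq0 // eq_sym.
move: (chain_series w) (tel _ _ _) (match w with nil => _ | _ => _ end) => a b c.
field; by rewrite h3 h4.
Qed.

End Chain.

(** * Deletion and contraction for the greedy weight *)

Section DeletionContraction.
Context {n : nat} (M : flag_matroid n) {F : fieldType} (t : 'I_n -> F) (q : F).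
Context (tI : injective t).
Context (q0 : q != 0).
Implicit Types (A S X : {set 'I_n}) (x y : 'I_n) (w s : seq 'I_n).

Local Notation rk1 := (rk (fm1 M)).
Local Notation rk2 := (rk (fm2 M)).

Definition jump1 A x := (rk1 A < rk1 (x |: A))%N.
Definition jump2 A x := (rk2 A < rk2 (x |: A))%N.

(* The local weight is [del_coef A x + con_coef A x * t x]. *)
Definition loc_weight A x : F :=
  if jump1 A x then t x else if jump2 A x then 1 + q * t x else 1.
Definition del_coef A x : F := (~~ jump1 A x)%:R.
Definition con_coef A x : F := if jump1 A x then 1 else if jump2 A x then q else 0.

Fixpoint weight A w : F :=
  if w is x :: w' then loc_weight A x * weight (x |: A) w' else 1.

Lemma jump_cond (N : matroid n) A x y :
  (rk N (y |: A) < rk N (x |: (y |: A)))%N -> (rk N A < rk N (x |: A))%N.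
Proof.
apply: contraTT; rewrite -!leqNgt => h.
rewrite rk_cond //; apply/eqP; by rewrite eqn_leq h rkS ?subsetU1.
Qed.

Lemma rkU1_jump (N : matroid n) A x :
  rk N (x |: A) = ((rk N A < rk N (x |: A)) + rk N A)%N.
Proof.
have := rkU1 N x A; have := rkS N _ _ (subsetU1 x A).
by case: ltngtP => //= h1 _ h2; apply/eqP; rewrite eqn_leq h2.
Qed.

(** Both sides count the rank gained from [A] to [A] with [x] and [y] added. *)
Lemma jump_swap (N : matroid n) A x y :
  ((rk N A < rk N (x |: A)) + (rk N (x |: A) < rk N (y |: (x |: A))) =
   (rk N A < rk N (y |: A)) + (rk N (y |: A) < rk N (x |: (y |: A))))%N.
Proof.
apply/eqP; rewrite -(eqn_add2r (rk N A)); apply/eqP.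
rewrite addnAC -rkU1_jump addnC -rkU1_jump.
by rewrite [RHS]addnAC -rkU1_jump [RHS]addnC -rkU1_jump setUCA.
Qed.

(** Eight bits record the jumps of the two matroids when [x] and [y] are added to [A] in either
    order. Additivity of rank, monotonicity of closure and the quotient condition exclude most
    patterns; in the remaining ones the denominator cancels. The right-hand side is written as a
    difference so that it telescopes along an order. *)
Lemma loc_weight_swap A x y : x != y ->
  t x / (t x - t y) *
    (loc_weight A x * loc_weight (x |: A) y - loc_weight A y * loc_weight (y |: A) x) =
  del_coef (x |: A) y * loc_weight A x - del_coef A y * loc_weight (y |: A) x.
Proof.
move=> xy; have h := diff_neq0 t tI _ _ xy.
have := jump_swap (fm1 M) A x y; have := jump_swap (fm2 M) A x y.
have := @jump_cond (fm1 M) A x y; have := @jump_cond (fm1 M) A y x.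
have := @jump_cond (fm2 M) A x y; have := @jump_cond (fm2 M) A y x.
have := @flag_jump _ M A x; have := @flag_jump _ M A y.
have := @flag_jump _ M (x |: A) y; have := @flag_jump _ M (y |: A) x.
rewrite /loc_weight /del_coef /jump1 /jump2.
case: (rk1 A < rk1 (x |: A))%N; case: (rk1 A < rk1 (y |: A))%N;
case: (rk1 (x |: A) < rk1 (y |: (x |: A)))%N;
case: (rk1 (y |: A) < rk1 (x |: (y |: A)))%N;
case: (rk2 A < rk2 (x |: A))%N; case: (rk2 A < rk2 (y |: A))%N;
case: (rk2 (x |: A) < rk2 (y |: (x |: A)))%N;
case: (rk2 (y |: A) < rk2 (x |: (y |: A)))%N;
 do ?[by move=> a b c d e f g i j k; (discriminate j || discriminate k || discriminate (a isT) ||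
  discriminate (b isT) || discriminate (c isT) || discriminate (d isT) || discriminate (e isT)
  || discriminate (f isT) || discriminate (g isT) || discriminate (i isT))];
 move=> _ _ _ _ _ _ _ _ _ _ /=; by field.
Qed.

(** Put [x] at a position of [w], replace its local weight by its [del_coef] there, and count it as
    read for the elements that follow. By [loc_weight_swap] each term of [tel] is the difference of
    this quantity at two neighbouring positions, so only the two ends survive. *)
Lemma tel_weight A x w : uniq w -> x \notin w ->
  tel t x (weight A) w =
  del_coef (A :|: [set y in w]) x * weight A w - del_coef A x * weight (x |: A) w.
Proof.
elim: w A => [|y w IH] A; first by rewrite /= set_nil setU0 mulr1 subrr.
rewrite /= in_cons negb_or => /andP[yw uw] /andP[xy xw].
rewrite (eq_tel t x _ (fun v => loc_weight A y * weight (y |: A) v) w) //.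
rewrite tel_scale IH // set_cons_swap.
have /= := loc_weight_swap A y x; rewrite eq_sym => /(_ xy) e.
rewrite ![y |: (x |: A)]setUCA; move: (weight (x |: _) w) (weight (y |: A) w) => W1 W2.
transitivity (t y / (t y - t x) * (loc_weight A y * loc_weight (y |: A) x
    - loc_weight A x * loc_weight (x |: A) y) * W1
  + loc_weight A y * (del_coef (A :|: [set z in y :: w]) x * W2 - del_coef (y |: A) x * W1));
  first by ring.
by rewrite e; ring.
Qed.

(** The term of a pseudo-basis of the minor on [X] obtained by contracting [A]: [S] spans over [A]
    in the first matroid and is independent over [A] in the second. The exponent in the denominator
    is the rank of the first matroid of the minor, since an element of B_1 has weight t_x and not q
    t_x. *)
Definition pseudo_term A X S : F :=
  if (rk1 (A :|: S) == rk1 (A :|: X)) && (rk2 (A :|: S) == rk2 A + #|S|)%N then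
    (\prod_(i in S) t i) * q ^+ #|S| / q ^+ (rk1 (A :|: X) - rk1 A)
  else 0.

Definition pseudo_sum A X : F := \sum_(S : {set 'I_n} | S \subset X) pseudo_term A X S.

(** The lower end of the telescoping sum cancels the part [del_coef A x] of the local weight of [x]
    at the head. What remains is a deletion term, which vanishes if [x] is a coloop of the first
    matroid of the minor, and a contraction term, which vanishes if [x] is a loop of the second. *)
Lemma weight_sum_cons A x s : uniq (x :: s) ->
  \sum_(w <- orders (x :: s)) chain_series t w * weight A w =
  del_coef (A :|: [set y in s]) x * (\sum_(w <- orders s) chain_series t w * weight A w)
  + con_coef A x * t x * (\sum_(w <- orders s) chain_series t w * weight (x |: A) w).
Proof.
move=> /= /andP[xs us]; rewrite big_orders_cons !big_distrr -big_split /=.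
apply: eq_big_seq => w /orders_perm e.
have uw : uniq w by rewrite (perm_uniq e).
have xw : x \notin w by rewrite (perm_mem e).
rewrite inserts_sum // tel_weight //=.
have -> : [set y in w] = [set y in s] by apply/setP => z; rewrite !inE (perm_mem e).
have -> : loc_weight A x = del_coef A x + con_coef A x * t x.
  by rewrite /loc_weight /del_coef /con_coef; case: (jump1 A x); case: (jump2 A x) => /=; ring.
ring.
Qed.

Lemma rkU_card (N : matroid n) A S : (rk N (A :|: S) <= rk N A + #|S|)%N.
Proof.
have [I hI [IA <-]] := rk_ex N (A :|: S); rewrite -(cardsID A I) leq_add //.
  by rewrite rk_indep ?subsetIr //; apply: indepS hI; rewrite subsetIl.
by rewrite subset_leq_card // subDset.
Qed.

(** A set that avoids [x] can span only if [x] lies in the closure of [A :|: X] in the first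
    matroid. *)
Lemma pseudo_term_del A X S x : S \subset X ->
  pseudo_term A (x |: X) S = del_coef (A :|: X) x * pseudo_term A X S.
Proof.
move=> SX; rewrite /pseudo_term /del_coef /jump1 [A :|: (x |: X)]setUCA.
case: ltnP => [lt|ge] /=.
  by rewrite mul0r ltn_eqF // (leq_ltn_trans _ lt) // rkS // setUS.
rewrite mul1r; have -> // : rk1 (x |: (A :|: X)) = rk1 (A :|: X).
by apply/eqP; rewrite eqn_leq ge rkS ?subsetU1.
Qed.

(** If [x] is a loop of the second matroid over [A], both sides vanish. Otherwise adding [x]
    contributes q t_x, and the factor q is cancelled by the denominator exactly when [x] also raises
    the rank of the first matroid. *)
Lemma pseudo_term_con A X S x : x \notin S -> S \subset X ->
  pseudo_term A (x |: X) (x |: S) = con_coef A x * t x * pseudo_term (x |: A) X S.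
Proof.
move=> xS SX; rewrite /pseudo_term /con_coef ![A :|: (x |: _)]setUCA ![x |: (A :|: _)]setUA.
rewrite cardsU1 xS big_setU1 //=.
case j2 : (jump2 A x); last first.
  have -> : jump1 A x = false by apply/negP => /flag_jump; rewrite -/(jump2 A x) j2.
  rewrite !mul0r; case: ifP => // /andP[_ /eqP e].
  have := rkU_card (fm2 M) (x |: A) S; rewrite e rkU1_jump -/(jump2 A x) j2.
  by rewrite add0n addnA addn1 ltnn.
have e2 : rk2 (x |: A) = (rk2 A).+1 by rewrite rkU1_jump -/(jump2 A x) j2.
rewrite e2 addnA addn1; case: ifP => _; rewrite ?mulr0 //.
have e1 := rkU1_jump (fm1 M) A x; rewrite -/(jump1 A x) in e1.
have le1 : (rk1 (x |: A) <= rk1 (x |: A :|: X))%N by rewrite rkS // subsetUl.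
move: le1 e1; case: (jump1 A x) => /= le1 e1.
  have -> : (rk1 (x |: A :|: X) - rk1 A = (rk1 (x |: A :|: X) - rk1 (x |: A)).+1)%N by lia.
  rewrite add1n !exprS; move: (_ - rk1 (x |: A))%N => e; have := expf_neq0 e q0.
  by move: (q ^+ e) (q ^+ #|S|) (\prod_(i in S) t i) => a b c a0; field; rewrite q0 a0.
by rewrite e1 add0n add1n exprS; ring.
Qed.

Lemma big_subset_U1 (V : nmodType) (f : {set 'I_n} -> V) X x : x \notin X ->
  \sum_(S : {set 'I_n} | S \subset x |: X) f S =
  \sum_(S : {set 'I_n} | S \subset X) (f S + f (x |: S)).
Proof.
move=> xX; rewrite big_split /= (bigID (fun S : {set 'I_n} => x \notin S)) /=.
have xS S : S \subset X -> x \notin S by move=> /subsetP SX; apply: contra xX => /SX.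
congr (_ + _).
  apply: eq_bigl => S; apply/andP/idP => [[SX xS']|SX].
    apply/subsetP => z zS; have := subsetP SX z zS; rewrite in_setU1 => /orP[/eqP ez|//].
    by rewrite -ez zS in xS'.
  by split; [apply: subset_trans SX (subsetU1 _ _) | exact: xS].
rewrite (reindex_onto (fun S => x |: S) (fun S => S :\ x)) /=; last first.
  by move=> S /andP[_ /negPn xS']; rewrite setD1K.
apply: eq_bigl => S; rewrite setU11 /= andbT.
apply/andP/idP => [[h /eqP e]|SX]; last by rewrite setUS // setU1K ?eqxx ?xS.
apply/subsetP => z zS; have := subsetP h z; rewrite !in_setU1 zS orbT => /(_ isT).
case/orP=> [/eqP ez|//]; by rewrite -e -ez !inE eqxx in zS.
Qed.

Lemma pseudo_sum_cons A X x : x \notin X ->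
  pseudo_sum A (x |: X) = del_coef (A :|: X) x * pseudo_sum A X
    + con_coef A x * t x * pseudo_sum (x |: A) X.
Proof.
move=> xX; rewrite /pseudo_sum big_subset_U1 // big_split /= !big_distrr /=.
congr (_ + _); apply: eq_bigr => S SX; first by rewrite pseudo_term_del.
by rewrite pseudo_term_con //; apply: contra xX => /(subsetP SX).
Qed.

Lemma weight_sum A s : uniq s ->
  \sum_(w <- orders s) chain_series t w * weight A w = pseudo_sum A [set y in s].
Proof.
elim: s A => [|x s IH] A us.
  rewrite /= big_seq1 /pseudo_sum set_nil (eq_bigl (pred1 set0)) => [|S]; last by rewrite subset0.
  by rewrite big_pred1_eq /pseudo_term setU0 eqxx cards0 addn0 eqxx big_set0 subnn /= !expr0 divr1.
rewrite weight_sum_cons //; move: us => /= /andP[xs us]; rewrite !IH //.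
have -> : [set y in x :: s] = x |: [set y in s] by apply/setP => z; rewrite !inE.
by rewrite pseudo_sum_cons // inE.
Qed.

Lemma weightE A w : uniq w ->
  weight A w = (\prod_(i in greedy (fm1 M) A w) t i)
    * \prod_(i in greedy (fm2 M) A w :\: greedy (fm1 M) A w) (1 + q * t i).
Proof.
elim: w A => [|x w IH] A; first by rewrite /= setD0 !big_set0 mulr1.
rewrite /= => /andP[xw uw]; rewrite IH //.
have x1 N : x \notin greedy N (x |: A) w by apply: contra xw => /greedy_sub.
rewrite /loc_weight /jump1 /jump2; have := @flag_jump _ M A x.
case: ifP => j1 => [/(_ isT) -> | _].
  rewrite big_setU1 ?x1 //= mulrA; congr (_ * _); apply: eq_bigl => z.
  by rewrite !inE; case: eqP => //= ->; rewrite (negbTE (x1 (fm2 M))) andbF.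
case: ifP => j2; last by rewrite mul1r.
rewrite setDUl mulrCA; congr (_ * _).
have -> : [set x] :\: greedy (fm1 M) (x |: A) w = [set x].
  by apply/setP => z; rewrite !inE andbC; case: eqP => //= ->; rewrite x1.
by rewrite big_setU1 //= !inE (negbTE (x1 (fm2 M))) andbF.
Qed.

Lemma greedy_sum s : uniq s -> (forall i, i \in s) ->
  \sum_(w <- orders s) chain_series t w *
     ((\prod_(i in (gflag M w).1) t i)
      * \prod_(i in (gflag M w).2 :\: (gflag M w).1) (1 + q * t i))
  = q ^- rk1 [set: 'I_n] * \sum_(S in pseudo_bases M) (\prod_(i in S) t i) * q ^+ #|S|.
Proof.
move=> us hs; transitivity (pseudo_sum set0 [set y in s]).
  rewrite -weight_sum //; apply: eq_big_seq => w /orders_perm e.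
  by rewrite weightE // (perm_uniq e).
have -> : [set y in s] = [set: 'I_n] by apply/setP => z; rewrite !inE hs.
rewrite /pseudo_sum (eq_bigl predT) => [|S]; last by rewrite subsetT.
rewrite big_distrr [RHS]big_mkcond /=; apply: eq_bigr => S _.
rewrite /pseudo_term !set0U !rk0 subn0 add0n inE /spanning rk_indepE.
by case: ifP => _ //; ring.
Qed.

End DeletionContraction.

(** * Multigraded series *)

Section Series.
Context {n : nat}.
Local Notation A := {mpoly rat[n]}.
Local Notation F := (ratfun n).
Implicit Types (D N P Q : A) (s : 'rV[int]_n -> rat) (w : 'rV[int]_n).

Lemma zmonD (a b : 'X_{1..n}) : zmon (a + b) = zmon a + zmon b.
Proof. by apply/rowP => i; rewrite !mxE mnmDE PoszD. Qed.

Lemma zmon0 : zmon 0%MM = 0 :> 'rV[int]_n.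
Proof. by apply/rowP => i; rewrite !mxE mnm0E. Qed.

Lemma zmonU i : zmon U_(i)%MM = delta_mx 0 i :> 'rV[int]_n.
Proof. by apply/rowP => j; rewrite !mxE mnm1E eqxx eq_sym; case: eqP. Qed.

Lemma mul_seriesE r P s w : uniq r -> {subset msupp P <= r} ->
  mul_series P s w = \sum_(m <- r) P@_m * s (w - zmon m).
Proof.
move=> ur h; rewrite /mul_series (bigID (fun m => m \in msupp P)) [in RHS](bigID (fun m => m \in msupp P)) /=.
rewrite [X in _ = _ + X]big1 ?addr0 => [|m]; last first.
  by rewrite mcoeff_msupp negbK => /eqP ->; rewrite mul0r.
rewrite [X in _ + X]big1_seq ?addr0 => [|m /andP[/negP]] //.
rewrite -big_filter -[RHS]big_filter; apply: perm_big.
apply: uniq_perm; rewrite ?filter_uniq ?msupp_uniq // => m.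
by rewrite !mem_filter; case mP: (m \in msupp P) => //=; rewrite h.
Qed.

Lemma mul_seriesDl P Q s w : mul_series (P + Q) s w = mul_series P s w + mul_series Q s w.
Proof.
pose r := undup (msupp P ++ msupp Q).
rewrite !(mul_seriesE r) ?undup_uniq //.
- by rewrite -big_split; apply: eq_bigr => m _; rewrite mcoeffD mulrDl.
- by move=> m; rewrite mem_undup mem_cat => ->; rewrite orbT.
- by move=> m; rewrite mem_undup mem_cat => ->.
- by move=> m /msuppD_le; rewrite mem_undup.
Qed.

Lemma mul_seriesX c m s w : mul_series (c *: 'X_[m]) s w = c * s (w - zmon m).
Proof.
rewrite (mul_seriesE [:: m]) //; last by move=> k /msuppZ_le; rewrite msuppX.
by rewrite big_seq1 mcoeffZ mcoeffX eqxx mulr1.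
Qed.

Lemma mul_series0 s w : mul_series 0 s w = 0.
Proof. by rewrite /mul_series msupp0 big_nil. Qed.

Lemma mul_series1 s w : mul_series 1 s w = s w.
Proof. by rewrite -[1]scale1r -mpolyX0 mul_seriesX mul1r zmon0 subr0. Qed.

Lemma mul_seriesBl P Q s w : mul_series (P - Q) s w = mul_series P s w - mul_series Q s w.
Proof. by apply/eqP; rewrite eq_sym subr_eq -mul_seriesDl subrK. Qed.

Lemma mul_series_sum (I : Type) (r : seq I) (G : I -> A) s w :
  mul_series (\sum_(i <- r) G i) s w = \sum_(i <- r) mul_series (G i) s w.
Proof.
elim: r => [|i r IH]; first by rewrite !big_nil mul_series0.
by rewrite !big_cons mul_seriesDl IH.
Qed.

Lemma eq_mul_series P s1 s2 : s1 =1 s2 -> mul_series P s1 =1 mul_series P s2.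
Proof. by move=> e w; apply: eq_bigr => m _; rewrite e. Qed.

Lemma mul_seriesM P Q s : mul_series (P * Q) s =1 mul_series P (mul_series Q s).
Proof.
move=> w; rewrite {1}(mpolyE P) {1}(mpolyE Q) mulr_suml mul_series_sum.
rewrite {2}/mul_series; apply: eq_bigr => a _.
rewrite mulr_sumr mul_series_sum {2}/mul_series mulr_sumr; apply: eq_bigr => b _.
rewrite -scalerAl -scalerAr scalerA -mpolyXD. rewrite mul_seriesX zmonD mulrA.
by rewrite opprD addrA.
Qed.

Lemma mul_seriesDr P s1 s2 w :
  mul_series P (fun z => s1 z + s2 z) w = mul_series P s1 w + mul_series P s2 w.
Proof. by rewrite -big_split; apply: eq_bigr => m _; rewrite mulrDr. Qed.

Definition unit_series w : rat := (w == 0)%:R.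

Lemma zcoefE N : zcoef N =1 mul_series N unit_series.
Proof.
move=> w; rewrite /zcoef big_mkcond; apply: eq_bigr => m _.
by rewrite /unit_series subr_eq0 eq_sym; case: eqP => _; rewrite ?mulr1 ?mulr0.
Qed.

(** The relation of [hilbert_spec], for arbitrary coefficient functions instead of indicator
    functions of cones, so that series can be added and subtracted. *)
Definition sums_to s (f : F) : Prop :=
  exists D N, [/\ D != 0, mul_series D s =1 mul_series N unit_series & f = tofrac N / tofrac D].

Lemma sums_to_ext s1 s2 f : s1 =1 s2 -> sums_to s1 f -> sums_to s2 f.
Proof.
move=> e [D [N [D0 h ->]]]; exists D, N; split=> // w.
by rewrite -h; apply: eq_mul_series => z; rewrite e.
Qed.

Lemma sums_to_unit : sums_to unit_series 1.
Proof. by exists 1, 1; rewrite oner_neq0 tofrac1 divr1. Qed.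

Lemma sums_toD s1 s2 f1 f2 : sums_to s1 f1 -> sums_to s2 f2 ->
  sums_to (fun w => s1 w + s2 w) (f1 + f2).
Proof.
move=> [D1 [N1 [D10 h1 ->]]] [D2 [N2 [D20 h2 ->]]].
exists (D1 * D2), (N1 * D2 + N2 * D1); split; first by rewrite mulf_neq0.
  move=> w; rewrite mul_seriesDr mul_seriesDl; congr (_ + _).
    by rewrite (mulrC D1) (mulrC N1) !mul_seriesM; exact: eq_mul_series.
  by rewrite (mulrC N2) !mul_seriesM; exact: eq_mul_series.
by rewrite tofracD !tofracM addf_div ?tofrac_eq0.
Qed.

Lemma sums_to_mul P Q s s' f : P != 0 -> mul_series P s =1 mul_series Q s' ->
  sums_to s' f -> sums_to s (tofrac Q / tofrac P * f).
Proof.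
move=> P0 e [D [N [D0 h ->]]]; exists (P * D), (Q * N); split; first by rewrite mulf_neq0.
  move=> w; rewrite (mulrC P) [LHS]mul_seriesM (eq_mul_series D _ _ e) -mul_seriesM (mulrC D).
  by rewrite !mul_seriesM; exact: eq_mul_series.
by rewrite !tofracM mulf_div.
Qed.

Lemma sums_toN s f : sums_to s f -> sums_to (fun w => - s w) (- f).
Proof.
move=> h; have -> : - f = tofrac (-1 : A) / tofrac (1 : A) * f.
  by rewrite tofracN !tofrac1 divr1 mulN1r.
apply: sums_to_mul h; first exact: oner_neq0.
by move=> w; rewrite -[-1]sub0r mul_seriesBl mul_series0 !mul_series1 sub0r.
Qed.

(* The series is killed by the binomial 1 - t^u. *)
Lemma sums_to_periodic s (u : 'rV[int]_n) : u != 0 -> (forall w, s (w + u) = s w) -> sums_to s 0.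
Proof.
move=> u0 per.
(* The positive and the negative part of [u]: multiplying by t^b turns t^u - 1 into the polynomial
   t^a - t^b. *)
pose a := [multinom (if (0 <= u 0%R i)%R then absz (u 0%R i) else 0%N) | i < n].
pose b := [multinom (if (0 <= u 0%R i)%R then 0%N else absz (u 0%R i)) | i < n].
have e : zmon a = zmon b + u.
  apply/rowP => i; rewrite !mxE !mnmE; case: (lerP 0 (u 0 i)) => h; first by rewrite gez0_abs ?add0r.
  by rewrite ltz0_abs ?addNr.
exists ('X_[a] - 'X_[b]), 0; split; last by rewrite tofrac0 mul0r.
  rewrite subr_eq0; apply/eqP => h; have : a = b.
    apply/eqP; have := congr1 (mcoeff a) h; rewrite !mcoeffX eqxx.
    by rewrite [b == a]eq_sym; case: (a == b).
  by move=> ab; move: e; rewrite ab -[LHS]addr0 => /addrI /eqP; rewrite eq_sym (negbTE u0).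
move=> w; rewrite mul_seriesBl mul_series0 -['X_[a]]scale1r -['X_[b]]scale1r !mul_seriesX !mul1r.
by rewrite e -(per (w - (zmon b + u))) opprD addrA subrK subrr.
Qed.

End Series.

(** * Tangent cones *)

Section Cones.
Context {R : realFieldType} {n : nat}.
Implicit Types (C : 'rV[R]_n -> Prop) (u v z : 'rV[R]_n) (x y p : 'I_n) (w : seq 'I_n).

Definition convex_cone C : Prop :=
  [/\ C 0, forall u v, C u -> C v -> C (u + v) & forall a v, 0 <= a -> C v -> C (a *: v)].

Definition add_ray C v : 'rV[R]_n -> Prop := fun z => exists2 a : R, 0 <= a & C (z - a *: v).

Definition add_line C v : 'rV[R]_n -> Prop := fun z => exists a : R, C (z - a *: v).

Lemma add_ray_cone C v : convex_cone C -> convex_cone (add_ray C v).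
Proof.
move=> [C0 CD CZ]; split.
- by exists 0 => //; rewrite scale0r subr0.
- move=> z1 z2 [a a0 h1] [b b0 h2]; exists (a + b); first exact: addr_ge0.
  by rewrite scalerDl opprD addrACA; apply: CD.
- move=> c z c0 [a a0 h]; exists (c * a); first exact: mulr_ge0.
  by rewrite -scalerA -scalerBr; apply: CZ.
Qed.

Lemma hilbert_fun_ext C C' : (forall z, C z <-> C' z) -> hilbert_fun C =1 hilbert_fun C'.
Proof.
by move=> e w; rewrite /hilbert_fun; do 2!case: excluded_middle_informative => // ?;
  exfalso; move: (e (map_mx intr w)); tauto.
Qed.

(* The overlap of the two half-spaces [C + R_+ v] and [C - R_+ v] is [C] by
   convexity, and their union is the cone [C + R v], which contains a line. *)
Lemma indicator_split C v : convex_cone C -> forall w : 'rV[int]_n,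
  hilbert_fun C w = hilbert_fun (add_ray C v) w + hilbert_fun (add_ray C (- v)) w
    - hilbert_fun (add_line C v) w.
Proof.
move=> [C0 CD CZ] w; rewrite /hilbert_fun; move: (map_mx intr w) => {w} z.
have e1 : C z <-> add_ray C v z /\ add_ray C (- v) z.
  split=> [h|[[a a0 ha] [b b0 hb]]].
    by split; exists 0; rewrite ?scale0r ?subr0.
  have := addr_ge0 a0 b0; rewrite le_eqVlt => /orP[|ab].
    rewrite eq_sym paddr_eq0 // => /andP[/eqP az _].
    by move: ha; rewrite az scale0r subr0.
  (* The convex combination of the two points of [C] in which the multiples of [v] cancel. *)
  have -> : z = (b / (a + b)) *: (z - a *: v) + (a / (a + b)) *: (z - b *: - v).
    apply/rowP => i; rewrite !mxE; field; by rewrite gt_eqF.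
  by apply: CD; apply: CZ => //; rewrite divr_ge0 // ltW.
have e2 : add_line C v z <-> add_ray C v z \/ add_ray C (- v) z.
  split=> [[a h]|[[a _ h]|[a _ h]]]; last 2 first.
  - by exists a.
  - by exists (- a); rewrite scaleNr -scalerN.
  have [a0|a0] := leP 0 a; first by left; exists a.
  by right; exists (- a); rewrite ?oppr_ge0 ?ltW // scaleNr scalerN opprK.
do 4!case: excluded_middle_informative => ?; first [by exfalso; tauto | by []].
Qed.

Definition ray p y : 'rV[R]_n := delta_mx 0 y - delta_mx 0 p.

Fixpoint chain C p w : 'rV[R]_n -> Prop :=
  if w is y :: w' then chain (add_ray C (ray p y)) y w' else C.

Definition chain0 C w := if w is x :: w' then chain C x w' else C.

Lemma add_ray_ext C C' v : (forall z, C z <-> C' z) ->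
  forall z, add_ray C v z <-> add_ray C' v z.
Proof. by move=> e z; split=> -[a a0 h]; exists a => //; apply/e. Qed.

Lemma chain_ext C C' p w : (forall z, C z <-> C' z) ->
  forall z, chain C p w z <-> chain C' p w z.
Proof. by elim: w p C C' => [|y w IH] p C C' e //=; apply: IH; exact: add_ray_ext. Qed.

Lemma add_rayC C u v z : add_ray (add_ray C u) v z <-> add_ray (add_ray C v) u z.
Proof.
by split=> -[a a0 [b b0 h]]; exists b => //; exists a => //; rewrite addrAC.
Qed.

Lemma chain_add_ray C u p w z : chain (add_ray C u) p w z <-> add_ray (chain C p w) u z.
Proof.
elim: w p C z => [|y w IH] p C z //=; rewrite -IH.
by apply: chain_ext => {}z; apply: add_rayC.
Qed.

Lemma chain_cone C p w : convex_cone C -> convex_cone (chain C p w).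
Proof. by elim: w p C => [|y w IH] p C h //=; apply: IH; exact: add_ray_cone. Qed.

Lemma add_ray_redundant C u v z :
  add_ray (add_ray (add_ray C u) (u + v)) v z <-> add_ray (add_ray C u) v z.
Proof.
split=> [[a a0 [b b0 [c c0 h]]]|[a a0 [b b0 h]]].
  exists (a + b); first exact: addr_ge0.
  exists (b + c); first exact: addr_ge0.
  congr C: h; apply/rowP => i; rewrite !mxE; ring.
exists a => //; exists 0 => //; rewrite scale0r subr0; by exists b.
Qed.

(** The third cone of [indicator_split] is invariant under translation by [u], so its series sums to
    0. *)
Lemma sums_to_split C (u : 'rV[int]_n) f1 f2 : convex_cone C -> u != 0 ->
  sums_to (hilbert_fun (add_ray C (map_mx intr u))) f1 ->
  sums_to (hilbert_fun (add_ray C (- map_mx intr u))) f2 ->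
  sums_to (hilbert_fun C) (f1 + f2).
Proof.
move=> hC u0 h1 h2; rewrite -[f1 + f2]subr0.
have h3 : sums_to (hilbert_fun (add_line C (map_mx intr u))) 0.
  apply: (sums_to_periodic _ u u0) => w.
  rewrite /hilbert_fun map_mxD.
  have e z v : add_line C v (z + v) <-> add_line C v z.
    split=> -[a h]; [exists (a - 1)|exists (a + 1)]; move: h; congr C;
      by apply/rowP => i; rewrite !mxE; ring.
  by do 2!case: excluded_middle_informative => // ?; exfalso; move: (e (map_mx intr w) (map_mx intr u)); tauto.
apply: sums_to_ext (sums_toD _ _ _ _ (sums_toD _ _ _ _ h1 h2) (sums_toN _ _ h3)) => w.
by rewrite (indicator_split C (map_mx intr u)).
Qed.

Definition zray p y : 'rV[int]_n := delta_mx 0 y - delta_mx 0 p.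

Lemma zrayE p y : map_mx intr (zray p y) = ray p y.
Proof. by rewrite map_mxB !map_delta_mx. Qed.

Lemma zray_neq0 p y : p != y -> zray p y != 0.
Proof.
move=> py; apply/eqP => /rowP /(_ y); rewrite !mxE !eqxx eq_sym (negbTE py).
by rewrite subr0.
Qed.

Lemma rayN p y : - ray p y = ray y p.
Proof. by rewrite /ray opprB. Qed.

(** The ray from [p] to [x] only records that [x] comes after [p]. Splitting along e_y - e_x decides
    between [x] before [y] and [x] after [y]. In the first half the ray from [p] to [y] is redundant
    and the chain runs through [x]; in the second the ray from [p] to [x] is redundant and the
    argument continues from [y]. *)
Lemma sums_to_inserts_after C p w x (h : seq 'I_n -> ratfun n) :
  convex_cone C -> x \notin p :: w ->
  (forall s, s \in inserts x w -> sums_to (hilbert_fun (chain C p s)) (h s)) ->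
  sums_to (hilbert_fun (chain (add_ray C (ray p x)) p w)) (\sum_(s <- inserts x w) h s).
Proof.
elim: w C p h => [|y w IH] C p h hC.
  by move=> _ hh; rewrite /= big_seq1; apply: (hh [:: x]); rewrite /= inE.
rewrite !inE !negb_or => /and3P[xp xy xw] hh.
rewrite [inserts _ _]/= big_cons big_map [chain _ _ _]/=.
have h1 := add_ray_cone C (ray p x) hC.
have h2 := add_ray_cone _ (ray p y) h1.
apply: (sums_to_split _ (zray x y)); first exact: chain_cone.
- by rewrite zray_neq0.
- have := hh [:: x, y & w]; rewrite /= inE eqxx => /(_ isT).
  apply: sums_to_ext; apply: hilbert_fun_ext => z.
  rewrite zrayE -chain_add_ray; apply: chain_ext => {}z.
  have -> : ray p y = ray p x + ray x y by apply/rowP => i; rewrite !mxE; ring.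
  by rewrite add_ray_redundant.
- rewrite zrayE rayN.
  have := IH (add_ray C (ray p y)) y (fun s => h (y :: s)) (add_ray_cone _ _ hC).
  rewrite inE negb_or xy => /(_ xw); case=> [s hs|D [N [D0 e1 e2]]].
    by apply: (hh (y :: s)); rewrite inE map_f ?orbT.
  suff : sums_to (hilbert_fun (chain (add_ray (add_ray C (ray p y)) (ray y x)) y w))
      (\sum_(j <- inserts x w) h (y :: j)).
    apply: sums_to_ext; apply: hilbert_fun_ext => z.
    rewrite -chain_add_ray; apply: chain_ext => {}z.
    have -> : ray p x = ray p y + ray y x by apply/rowP => i; rewrite !mxE; ring.
    by rewrite -add_ray_redundant; split=> -[a a0 h']; exists a => //; exact/add_rayC.
  by exists D, N.
Qed.

Lemma sums_to_inserts C w x (h : seq 'I_n -> ratfun n) :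
  convex_cone C -> x \notin w ->
  (forall s, s \in inserts x w -> sums_to (hilbert_fun (chain0 C s)) (h s)) ->
  sums_to (hilbert_fun (chain0 C w)) (\sum_(s <- inserts x w) h s).
Proof.
case: w => [|y w] hC.
  by move=> _ hh; rewrite /= big_seq1; apply: (hh [:: x]); rewrite /= inE.
rewrite !inE !negb_or => /andP[xy xw] hh; rewrite [inserts _ _]/= big_cons big_map [chain0 _ _]/=.
apply: (sums_to_split _ (zray x y)); first exact: chain_cone.
- by rewrite zray_neq0.
- have := hh [:: x, y & w]; rewrite /= inE eqxx => /(_ isT).
  by apply: sums_to_ext; apply: hilbert_fun_ext => z; rewrite zrayE -chain_add_ray.
- rewrite zrayE rayN.
  apply: (sums_to_ext _ _ _ (hilbert_fun_ext _ _ (chain_add_ray C (ray y x) y w))).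
  apply: (sums_to_inserts_after C y w x (fun s => h (y :: s))) => //.
    by rewrite inE negb_or xy.
  by move=> s hs; apply: (hh (y :: s)); rewrite inE map_f ?orbT.
Qed.

Lemma sums_to_orders C (s : seq 'I_n) (h : seq 'I_n -> ratfun n) :
  convex_cone C -> uniq s ->
  (forall w, w \in orders s -> sums_to (hilbert_fun (chain0 C w)) (h w)) ->
  sums_to (hilbert_fun C) (\sum_(w <- orders s) h w).
Proof.
move=> hC; elim: s h => [|x s IH] h us hh.
  by rewrite /= big_seq1; apply: (hh [::]); rewrite inE.
move: us => /= /andP[xs us]; rewrite big_orders_cons.
apply: IH => // w hw; apply: sums_to_inserts => //.
  by rewrite (perm_mem (orders_perm _ _ hw)).
by move=> v hv; apply: hh; apply/flatten_mapP; exists w.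
Qed.

(* The cone generated by the rays along [p :: w]; an element is cleared from the
   left, each partial sum being the coefficient of one ray. *)
Fixpoint path_cone p w v : Prop :=
  if w is y :: w' then v 0 p <= 0 /\ path_cone y w' (v + v 0 p *: ray p y) else v = 0.

Lemma path_coneD p w u v : path_cone p w u -> path_cone p w v -> path_cone p w (u + v).
Proof.
elim: w p u v => [|y w IH] p u v /=; first by move=> -> ->; rewrite addr0.
move=> [u0 hu] [v0 hv]; rewrite mxE; split; first by rewrite -oppr_ge0 opprD addr_ge0 ?oppr_ge0.
have := IH _ _ _ hu hv; congr (path_cone _ _ _).
by rewrite scalerDl addrACA.
Qed.

Lemma path_coneZ p w (a : R) v : 0 <= a -> path_cone p w v -> path_cone p w (a *: v).
Proof.
move=> a0; elim: w p v => [|y w IH] p v /=; first by move=> ->; rewrite scaler0.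
move=> [v0 hv]; rewrite mxE mulr_ge0_le0 //; split=> //.
by have := IH _ _ hv; rewrite scalerDr scalerA.
Qed.

Lemma path_cone_supp p w v i : path_cone p w v -> i \notin p :: w -> v 0 i = 0.
Proof.
elim: w p v => [|y w IH] p v /=; first by move=> ->; rewrite mxE.
move=> [_ /IH h]; rewrite !inE !negb_or => /and3P[ip iy iw].
have := h; rewrite inE negb_or iy iw => /(_ isT).
by rewrite !mxE !eqxx (negbTE ip) (negbTE iy) subrr mulr0 addr0.
Qed.

Lemma path_cone_sub p y w v : p \notin y :: w -> path_cone y w v -> path_cone p (y :: w) v.
Proof.
move=> hp h /=; have e := path_cone_supp _ _ _ _ h hp.
by rewrite e lexx scale0r addr0.
Qed.

Lemma ray_tail p y : p != y -> ray p y 0 p = -1.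
Proof. by move=> py; rewrite !mxE !eqxx (negbTE py) sub0r. Qed.

Lemma chain_sub (X : 'rV[R]_n -> Prop) C p w :
  (forall v, C v -> X v) -> (forall u v, X u -> X v -> X (u + v)) ->
  (forall (a : R) v, 0 <= a -> X v -> X (a *: v)) ->
  (forall l x y r, p :: w = l ++ [:: x, y & r] -> X (ray x y)) ->
  forall z, chain C p w z -> X z.
Proof.
move=> CX XD XZ; elim: w p C CX => [|y w IH] p C CX hr z //=; first exact: CX.
apply: IH => [v [a a0 h]|l x y' r e]; last by apply: (hr (p :: l) x y' r); rewrite /= e.
rewrite -[v](subrK (a *: ray p y)); apply: XD; first exact: CX.
by apply: XZ => //; apply: (hr [::] p y w).
Qed.

Lemma path_cone0 p w : path_cone p w 0.
Proof.
by elim: w p => [|y w IH] p //=; rewrite !mxE scale0r addr0.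
Qed.

Lemma path_cone_ray p w l x y r : uniq (p :: w) -> p :: w = l ++ [:: x, y & r] ->
  path_cone p w (ray x y).
Proof.
elim: l p w => [|q l IH] p w u /= [] pe we.
  have xy : x != y by move: u; rewrite pe we /= inE negb_or => /andP[/andP[]].
  rewrite pe we /= ray_tail // scaleN1r subrr oppr_le0 ler01; split=> //; exact: path_cone0.
move: u we; rewrite [uniq _]/=; case: w => [|y0 w]; first by case: l {IH}.
move=> /andP[pw u] e; apply: path_cone_sub => //; exact: IH e.
Qed.

Lemma chain_path C p w z v : chain C p w z -> path_cone p w v -> chain C p w (z + v).
Proof.
elim: w p z v => [|y w IH] p z v /=; first by move=> h ->; rewrite addr0.
move=> /chain_add_ray[b b0 h] [v0 /(IH _ _ _ h) h']; apply/chain_add_ray.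
exists (b - v 0 p); first by rewrite subr_ge0 (le_trans v0).
by congr (chain _ _ _): h'; apply/rowP => i; rewrite !mxE; ring.
Qed.

(** For such [C] the enlarged cone depends on the order alone, and so does its Hilbert series. *)
Lemma chain_pathE C p w : uniq (p :: w) -> C 0 -> (forall v, C v -> path_cone p w v) ->
  forall z, chain C p w z <-> path_cone p w z.
Proof.
move=> u C0 CX z; split=> [|h].
  apply: (chain_sub (path_cone p w)) z => //.
  - exact: path_coneD.
  - exact: path_coneZ.
  - move=> l x y r; exact: path_cone_ray.
rewrite -[z]add0r; apply: chain_path => //.
by elim: w p {u CX z h} => [|y w IH] p //=; apply/chain_add_ray; exists 0; rewrite ?scale0r ?subr0.
Qed.

(** A lattice point of the cone either has coordinate 0 at [p], and then lies in the cone of the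
    shorter path, or has coordinate at most -1 by integrality, and then lies in the translate of the
    whole cone by e_y - e_p. Hence (t_p - t_y) H = t_p H', where H' belongs to the shorter path. *)
Lemma sums_to_path_cone p w : uniq (p :: w) ->
  sums_to (hilbert_fun (path_cone p w)) (chain_series (@tvar n) (p :: w)).
Proof.
elim: w p => [|y w IH] p.
  move=> _; rewrite /= mulr1; apply: sums_to_ext sums_to_unit => z.
  rewrite /unit_series /hilbert_fun; case: excluded_middle_informative => /= h.
    suff -> : z = 0 by rewrite eqxx.
    apply/rowP => i; have := congr1 (fun v : 'rV[R]_n => v 0 i) h; rewrite !mxE.
    by move/eqP; rewrite intr_eq0 => /eqP.
  by case: eqP => // ze; case: h; rewrite ze map_mx0.
rewrite [uniq _]/= => /andP[pw u]; have py : p != y by move: pw; rewrite inE negb_or => /andP[].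
rewrite [chain_series _ _]/= -/(chain_series (@tvar n) (y :: w)) /tvar -tofracB.
apply: sums_to_mul (IH y u).
  rewrite subr_eq0; apply/eqP => /(congr1 (mcoeff U_(p))); rewrite !mcoeffX eqxx.
  by rewrite eq_mnm1 eq_sym (negbTE py).
move=> z; rewrite mul_seriesBl -['X_p]scale1r -['X_y]scale1r !mul_seriesX !mul1r !zmonU.
have -> : z - delta_mx 0 y = z - delta_mx 0 p - zray p y.
  by apply/rowP => i; rewrite !mxE; ring.
move: (z - delta_mx 0 p) => {}z; rewrite /hilbert_fun map_mxB zrayE.
have e1 : path_cone y w (map_mx intr z) <-> z 0 p = 0 /\ path_cone p (y :: w) (map_mx intr z).
  split=> [h|[z0 [_]]]; last by rewrite mxE z0 scale0r addr0.
  split; last exact: path_cone_sub.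
  have := path_cone_supp _ _ _ _ h pw; rewrite mxE => /eqP; by rewrite intr_eq0 => /eqP.
have e2 : path_cone p (y :: w) (map_mx intr z - ray p y) <->
    z 0 p <= -1 /\ path_cone p (y :: w) (map_mx intr z).
  have e : map_mx intr z - ray p y + (map_mx intr z - ray p y) 0 p *: ray p y =
           map_mx intr z + (map_mx intr z) 0 p *: ray p y.
    have -> : (map_mx intr z - ray p y) 0 p = (map_mx intr z) 0 p + 1.
      by rewrite mxE [(- ray p y) 0 p]mxE ray_tail // opprK.
    by apply/rowP => i; rewrite !mxE; ring.
  have e0 : ((map_mx intr z - ray p y) 0 p <= 0) = (z 0 p <= -1).
    rewrite mxE [(- ray p y) 0 p]mxE ray_tail // opprK mxE -[1]/(1%:~R) -intrD.
    by rewrite lerz0 -lerBrDr sub0r.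
  rewrite /= e e0 [(map_mx intr z) 0 p <= 0](_ : _ = (z 0 p <= 0)); last by rewrite mxE lerz0.
  split=> [[h1 h2]|[h1 [_ h2]]] //; split=> //; split=> //; lia.
have e3 : path_cone p (y :: w) (map_mx intr z) -> z 0 p <= 0.
  by move=> /= [+ _]; rewrite mxE lerz0.
have n1 : ~ (z 0 p <= -1 /\ z 0 p = 0) by lia.
have n2 : z 0 p <= 0 -> z 0 p <= -1 \/ z 0 p = 0 by lia.
do 3!case: excluded_middle_informative => ?;
  first [by rewrite ?subrr ?subr0 | by exfalso; tauto].
Qed.

(** The coefficient of each ray is minus the sum of the coordinates up to the tail of that ray, so
    only the signs of partial sums matter. *)
Lemma path_coneI p w v : uniq (p :: w) ->
  (forall l r, p :: w = l ++ r -> \sum_(i <- l) v 0 i <= 0) ->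
  \sum_(i <- p :: w) v 0 i = 0 -> (forall i, i \notin p :: w -> v 0 i = 0) ->
  path_cone p w v.
Proof.
elim: w p v => [|y w IH] p v u part tot supp /=.
  apply/rowP => i; rewrite mxE; have [->|ip] := eqVneq i p.
    by move: tot; rewrite big_seq1.
  by apply: supp; rewrite inE.
move: u; rewrite [uniq _]/= => /andP[pw u].
have [py pw'] : p != y /\ p \notin w by apply/andP; move: pw; rewrite inE negb_or.
have [yw uw] : y \notin w /\ uniq w by apply/andP.
have vy : (v + v 0 p *: ray p y) 0 y = v 0 p + v 0 y.
  by rewrite !mxE !eqxx [y == p]eq_sym (negbTE py) subr0 mulr1 addrC.
have vo i : i != p -> i != y -> (v + v 0 p *: ray p y) 0 i = v 0 i.
  by move=> ip iy; rewrite !mxE !eqxx (negbTE ip) (negbTE iy) subrr mulr0 addr0.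
have vl l : {subset l <= w} -> \sum_(i <- l) (v + v 0 p *: ray p y) 0 i = \sum_(i <- l) v 0 i.
  move=> lw; apply: eq_big_seq => i /lw iw; apply: vo.
    by apply: contraNneq pw' => <-.
  by apply: contraNneq yw => <-.
split; first by have := part [:: p] (y :: w) erefl; rewrite big_seq1.
apply: IH => //.
- case=> [|z l] r; first by rewrite big_nil.
  move=> [<- e]; rewrite big_cons vy vl; last by move=> i il; rewrite e mem_cat il.
  by have := part [:: p, y & l] r; rewrite e !big_cons addrA => ->.
- by move: tot; rewrite !big_cons vy vl // addrA.
- move=> i iyw; have [->|ip] := eqVneq i p.
    by rewrite mxE [(v 0 p *: ray p y) 0 p]mxE ray_tail // mulrN1 subrr.
  by move: (iyw); rewrite inE negb_or => /andP[iy iw]; rewrite vo // supp // !inE !negb_or ip iy.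
Qed.

Lemma conic_hull_cone (X : 'rV[R]_n -> Prop) : convex_cone (conic_hull X).
Proof.
split.
- by exists [::]; rewrite big_nil.
- move=> u v [s [hs ->]] [r [hr ->]]; exists (s ++ r); rewrite big_cat; split=> // x.
  by rewrite mem_cat => /orP[/hs|/hr].
- move=> a v a0 [s [hs ->]]; exists [seq (a * c.1, c.2) | c <- s]; split.
    by move=> c /mapP[z /hs [z0 hz] ->]; split=> //=; exact: mulr_ge0.
  by rewrite big_map scaler_sumr; apply: eq_bigr => x _; rewrite scalerA.
Qed.

End Cones.

(** * Hilbert series of the tangent cones of the base polytope *)

Section TangentCone.
Context {R : realFieldType} {n : nat} (M : flag_matroid n).
Implicit Types (B : set_flag n) (v : 'rV[R]_n) (l w : seq 'I_n).

Local Notation vert B := (evec R B.1 + evec R B.2).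

Lemma tangent_cone_le (a : 'I_n -> R) B v :
  (forall B', B' \in flag_bases M ->
     \sum_i a i * vert B' 0 i <= \sum_i a i * vert B 0 i) ->
  tangent_cone M B v -> \sum_i a i * v 0 i <= 0.
Proof.
pose phi v := \sum_i a i * (v : 'rV[R]_n) 0 i; rewrite -/(phi _).
have phiD u z : phi (u + z) = phi u + phi z.
  by rewrite -big_split; apply: eq_bigr => i _; rewrite mxE mulrDr.
have phiZ c u : phi (c *: u) = c * phi u.
  by rewrite big_distrr; apply: eq_bigr => i _; rewrite mxE mulrCA.
have phi_sum s : phi (\sum_(x <- s) x.1 *: x.2) = \sum_(x <- s) x.1 * phi x.2.
  elim: s => [|x s IH]; last by rewrite !big_cons phiD phiZ IH.
  by rewrite !big_nil /phi big1 // => i _; rewrite mxE mulr0.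
move=> hB [s [hs ->]]; rewrite phi_sum big_seq sumr_le0 // => x /hs [x0 [r [hr r1 e]]].
rewrite mulr_ge0_le0 //; move: (congr1 phi e); rewrite -addrA phiD phi_sum => e'.
rewrite -(lerD2r (phi (vert B))) e' add0r -[leRHS]mul1r -r1 mulr_suml.
rewrite big_seq [leRHS]big_seq; apply: ler_sum => z /hr [z0 [B' hB' ->]].
by rewrite ler_wpM2l //; exact: hB.
Qed.

Lemma vert_mem B B' : B' \in flag_bases M -> tangent_cone M B (vert B' - vert B).
Proof.
move=> hB'; exists [:: (1, vert B' - vert B)]; rewrite big_seq1 scale1r; split=> // x.
rewrite inE => /eqP -> /=; split=> //; exists [:: (1, vert B')].
rewrite !big_seq1 scale1r -addrA subrK; split=> // z; rewrite inE => /eqP -> /=.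
by split=> //; exists B'.
Qed.

Lemma evec_sum (S : {set 'I_n}) l : uniq l ->
  \sum_(i <- l) evec R S 0 i = #|S :&: [set i in l]|%:R.
Proof.
move=> ul; rewrite (eq_bigr (fun i => (i \in S)%:R)) => [|i _]; last by rewrite mxE.
rewrite big_uniq //= -natr_sum -sum1_card big_mkcond [in RHS]big_mkcond /=; congr _%:R.
by apply: eq_bigr => i _; rewrite !inE andbC; case: (i \in l) => //=; case: (i \in S).
Qed.

Lemma vert_sum B l : uniq l ->
  \sum_(i <- l) vert B 0 i = (#|B.1 :&: [set i in l]| + #|B.2 :&: [set i in l]|)%:R.
Proof.
move=> ul; rewrite natrD -!evec_sum // -big_split; apply: eq_bigr => i _.
by rewrite mxE.
Qed.

Lemma sum_mem l v : uniq l -> \sum_i (i \in l)%:R * v 0 i = \sum_(i <- l) v 0 i.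
Proof.
move=> ul; rewrite [RHS]big_uniq //= [RHS]big_mkcond /=; apply: eq_bigr => i _.
by case: (i \in l); rewrite (mul1r, mul0r).
Qed.

Lemma vert_le l r B : uniq (l ++ r) -> B \in flag_bases M ->
  \sum_(i <- l) vert B 0 i <= \sum_(i <- l) vert (gflag M (l ++ r)) 0 i.
Proof.
move=> u; rewrite inE => /and3P[]; rewrite !basisE => /andP[h1 _] /andP[h2 _] _.
have ul : uniq l by move: u; rewrite cat_uniq => /and3P[].
by rewrite !vert_sum // ler_nat leq_add // greedy_dom.
Qed.

Lemma vert_total B B' w : uniq w -> (forall i, i \in w) ->
  B \in flag_bases M -> B' \in flag_bases M ->
  \sum_(i <- w) vert B 0 i = \sum_(i <- w) vert B' 0 i.
Proof.
move=> u hw; rewrite !inE !basisE => /and3P[/andP[_ /eqP e1] /andP[_ /eqP e2] _].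
move=> /and3P[/andP[_ /eqP e1'] /andP[_ /eqP e2'] _].
rewrite !vert_sum //; have -> : [set i in w] = setT by apply/setP => i; rewrite !inE hw.
by rewrite !setIT e1 e2 e1' e2'.
Qed.

(** As [B.1 \subset B.2], a coordinate 2, 1 or 0 means membership in both sets, in the second only,
    or in neither. *)
Lemma vert_inj B B' : B \in flag_bases M -> B' \in flag_bases M ->
  vert B = vert B' -> B = B'.
Proof.
rewrite !inE => /and3P[_ _ /subsetP s] /and3P[_ _ /subsetP s'] /rowP e.
have h i : (i \in B.1) = (i \in B'.1) /\ (i \in B.2) = (i \in B'.2).
  have /eqP := e i; rewrite !mxE -!natrD eqr_nat.
  have := s i; have := s' i; case: (i \in B.1); case: (i \in B'.1);
  case: (i \in B.2); case: (i \in B'.2) => a b c;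
  first [by split | by move: c | by move: (a isT) | by move: (b isT)].
case: B B' h {s s' e} => [B1 B2] [B1' B2'] h; congr (_, _); apply/setP => i; by case: (h i).
Qed.

Definition zvert B : 'rV[int]_n := \row_i ((i \in B.1) + (i \in B.2))%N%:Z.

Lemma zvertE B : map_mx intr (zvert B) = vert B.
Proof. by apply/rowP => i; rewrite !mxE -natrD. Qed.

Lemma chain_add C p w (u : 'rV[R]_n) : (forall z, C z -> C (z + u)) ->
  forall z, chain C p w z -> chain C p w (z + u).
Proof.
elim: w p C => [|y w IH] p C h //=; apply: IH => z [a a0 hz]; exists a => //.
by rewrite addrAC; exact: h.
Qed.

(** If [B] is the greedy flag of [w], dominance on initial segments puts the tangent cone inside the
    path cone, and the enlarged cone is the path cone. Otherwise the difference between the greedy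
    vertex and the vertex of [B] lies in the tangent cone, and its opposite lies in the path cone by
    dominance; the enlarged cone contains a line and its series sums to 0. *)
Lemma sums_to_greedy B w : uniq w -> (forall i, i \in w) -> B \in flag_bases M ->
  sums_to (hilbert_fun (chain0 (tangent_cone (R := R) M B) w))
    (if gflag M w == B then chain_series (@tvar n) w else 0).
Proof.
move=> u hw hB; have hc := conic_hull_cone (fun v => base_polytope M (v + evec R B.1 + evec R B.2)).
have hg := gflag_basis M w hw.
have [C0 CD _] := hc; case: w u hw hg => [|p w] u hw hg.
  (* An empty list containing every index forces n = 0, so there is only one vector. *)
  have n0 (z : 'rV[int]_n) : z = 0 by apply/rowP => i; have := hw i.
  have -> : gflag M [::] == B.
    apply/eqP; apply: vert_inj => //; apply/rowP => i; by have := hw i.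
  apply: sums_to_ext sums_to_unit => z.
  rewrite (n0 z) /unit_series eqxx /hilbert_fun; case: excluded_middle_informative => // -[].
  by rewrite map_mx0.
rewrite /chain0; case: eqP => [e|ne].
  apply: sums_to_ext (sums_to_path_cone (R := R) p w u) => z; apply: hilbert_fun_ext => {}z.
  apply: iff_sym; apply: chain_pathE => // v hv; apply: path_coneI => //.
  - move=> l r e'; have ul : uniq l by move: u; rewrite e' cat_uniq => /and3P[].
    rewrite -sum_mem //; apply: tangent_cone_le hv => B' hB'.
    by rewrite !sum_mem // -e e'; apply: vert_le => //; rewrite -e'.
  (* All the vertices have the same coordinate sum, so this sum and its negative are both maximal at
     [B]. *)
  - apply/eqP; rewrite eq_le -{1}sum_mem //; apply/andP; split.
      apply: tangent_cone_le hv => B' hB'.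
      by rewrite !sum_mem // (vert_total B' B).
    rewrite -oppr_le0 -sum_mem // -sumrN.
    rewrite (eq_bigr (fun i => (- (i \in p :: w)%:R) * v 0 i)) => [|i _]; last by rewrite mulNr.
    apply: tangent_cone_le hv => B' hB'.
    rewrite (eq_bigr (fun i => - ((i \in p :: w)%:R * vert B' 0 i))) => [|i _]; last by rewrite mulNr.
    rewrite [leRHS](eq_bigr (fun i => - ((i \in p :: w)%:R * vert B 0 i))) => [|i _]; last by rewrite mulNr.
    by rewrite !sumrN !sum_mem // (vert_total B' B).
  - by move=> i; rewrite hw.
apply: (sums_to_periodic _ (zvert (gflag M (p :: w)) - zvert B)).
  rewrite subr_eq0; apply/eqP => /(congr1 (map_mx (intr : int -> R))); rewrite !zvertE => e.
  by apply: ne; exact: vert_inj.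
move=> z; rewrite /hilbert_fun map_mxD map_mxB !zvertE.
set g := vert (gflag M _).
have h v : chain (tangent_cone M B) p w (v + (g - vert B)) <-> chain (tangent_cone M B) p w v.
  split=> [hv|]; last first.
    apply: chain_add => {}v hv; apply: CD => //; exact: vert_mem.
  have -> : v = v + (g - vert B) + (vert B - g) by rewrite -addrA -opprB addNr addr0.
  have sB (l : seq 'I_n) : \sum_(i <- l) (vert B - g) 0 i = \sum_(i <- l) vert B 0 i - \sum_(i <- l) g 0 i.
    by rewrite -sumrN -big_split; apply: eq_bigr => i _; rewrite !mxE.
  apply: chain_path => //; apply: path_coneI => // [l r e||i]; rewrite ?sB ?hw //.
    by rewrite subr_le0 /g e; apply: vert_le => //; rewrite -e.
  by rewrite (vert_total B (gflag M (p :: w))) ?subrr.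
by do 2!case: excluded_middle_informative => // ?; exfalso;
  move: (h (map_mx intr z)); tauto.
Qed.

(** [hilb] is a choice by [epsilon]; it is identified by exhibiting a solution of [hilbert_spec] and
    using uniqueness. *)
Lemma hilb_tangent_cone B : B \in flag_bases M ->
  hilb (tangent_cone (R := R) M B) =
  \sum_(w <- orders (enum 'I_n) | gflag M w == B) chain_series (@tvar n) w.
Proof.
move=> hB; set f := RHS.
have h : hilbert_spec (tangent_cone (R := R) M B) f.
  have [D [N [D0 e fe]]] : sums_to (hilbert_fun (tangent_cone (R := R) M B)) f.
    rewrite /f big_mkcond; apply: sums_to_orders; first exact: conic_hull_cone.
      exact: enum_uniq.
    move=> w hw; have e := orders_perm _ _ hw; apply: sums_to_greedy => // [|i].
      by rewrite (perm_uniq e) enum_uniq.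
    by rewrite (perm_mem e) mem_enum.
  by exists D, N; split=> // z; rewrite zcoefE e.
by apply: (hilbert_spec_unique _ h); rewrite /hilb; apply: epsilon_spec; exists f.
Qed.

End TangentCone.

(** * Congruences and polynomiality *)

Section GKM.
Context {n : nat}.
Local Notation A := {mpoly rat[n]}.
Local Notation F := (ratfun n).
Local Notation T := (@tvar n).
Implicit Types (x y z k : 'I_n) (w l r s : seq 'I_n) (P Q : A) (f : seq 'I_n -> A).

Definition identify x y i : 'I_n := if i == x then y else i.

(* Reduction modulo 'X_x - 'X_y. *)
Fact coll_key : unit. Proof. exact: tt. Qed.
Definition coll x y : A -> A :=
  locked_with coll_key (comp_mpoly [tuple 'X_(identify x y i) | i < n]).

Lemma collE x y P : coll x y P = P \mPo [tuple 'X_(identify x y i) | i < n].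
Proof. by rewrite /coll unlock. Qed.

Lemma coll_is_zmod_morphism x y : zmod_morphism (coll x y).
Proof. by move=> P Q; rewrite !collE comp_mpolyB. Qed.

Lemma coll_is_monoid_morphism x y : monoid_morphism (coll x y).
Proof. by split=> [|P Q]; rewrite !collE ?comp_mpoly1 // rmorphM. Qed.

HB.instance Definition _ x y :=
  GRing.isZmodMorphism.Build A A (coll x y) (coll_is_zmod_morphism x y).
HB.instance Definition _ x y :=
  GRing.isMonoidMorphism.Build A A (coll x y) (coll_is_monoid_morphism x y).

Lemma collD x y P Q : coll x y (P + Q) = coll x y P + coll x y Q.
Proof. exact: rmorphD. Qed.

Lemma collB x y P Q : coll x y (P - Q) = coll x y P - coll x y Q.
Proof. exact: rmorphB. Qed.

Lemma collM x y P Q : coll x y (P * Q) = coll x y P * coll x y Q.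
Proof. exact: rmorphM. Qed.

Lemma collX x y i : coll x y 'X_i = 'X_(identify x y i).
Proof. by rewrite collE comp_mpolyXU -tnth_nth tnth_mktuple. Qed.

Lemma mpolyX_inj : injective (fun i : 'I_n => 'X_i : A).
Proof.
move=> i j /(congr1 (mcoeff U_(i))); rewrite !mcoeffX eqxx eq_mnm1.
by case: eqP => // _ /eqP; rewrite oner_eq0.
Qed.

Lemma tvar_inj : injective T.
Proof. by move=> i j /eqP; rewrite tofrac_eq => /eqP /mpolyX_inj. Qed.

Lemma subX_neq0 x y : x != y -> 'X_x - 'X_y != 0 :> A.
Proof. by rewrite subr_eq0; apply: contraNneq => /mpolyX_inj ->. Qed.

(** Divisibility passes to products by UV - U'V' = (U - U')V + U'(V - V'), so it is enough to check
    the variables. The boolean equality allows [xchoose] to extract the quotient. *)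
Lemma coll_divides x y P : exists Q, P - coll x y P == ('X_x - 'X_y) * Q.
Proof.
have prod U V : (exists Q, U - coll x y U == ('X_x - 'X_y) * Q) ->
    (exists Q, V - coll x y V == ('X_x - 'X_y) * Q) ->
    exists Q, U * V - coll x y (U * V) == ('X_x - 'X_y) * Q.
  move=> [Q1 /eqP e1] [Q2 /eqP e2]; exists (Q1 * V + coll x y U * Q2); apply/eqP.
  by rewrite collM mulrDr !mulrA -e1 [_ * coll x y U]mulrC -mulrA -e2; ring.
have one : exists Q, 1 - coll x y 1 == ('X_x - 'X_y) * Q.
  by exists 0; rewrite rmorph1 mulr0 subrr.
elim/mpolyind: P => [|c m p _ _ [Q /eqP e]].
  by exists 0; rewrite rmorph0 mulr0 subrr.
have [Q' /eqP e'] : exists Q, 'X_[m] - coll x y 'X_[m] == ('X_x - 'X_y) * Q.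
  rewrite (mpolyXE_id rat m); elim/big_ind: _ => // i _; elim: (m i) => [|d IH] //.
  rewrite exprS; apply: prod => //; rewrite collX /identify.
  by case: eqP => [->|_]; [exists 1; rewrite mulr1 | exists 0; rewrite mulr0 subrr].
exists (c *: Q' + Q); apply/eqP; rewrite collD mulrDr -e -scalerAr -e'.
have -> : coll x y (c *: 'X_[m]) = c *: coll x y 'X_[m] by rewrite !collE comp_mpolyZ.
by rewrite scalerBr opprD addrACA.
Qed.

Lemma quo_sig x y P : {Q : A | P - coll x y P == ('X_x - 'X_y) * Q}.
Proof. by exists (xchoose (coll_divides x y P)); apply: (xchooseP (coll_divides x y P)). Qed.

Definition quo x y P : A := sval (quo_sig x y P).

Lemma quoE x y P : coll x y P = 0 -> ('X_x - 'X_y) * quo x y P = P.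
Proof. by move=> e; have /eqP <- := svalP (quo_sig x y P); rewrite e subr0. Qed.

Lemma coll_sub_neq0 y z x k : x != k -> k != y -> k != z -> coll y z ('X_x - 'X_k) != 0.
Proof.
move=> xk ky kz; rewrite collB !collX; apply: subX_neq0; rewrite /identify (negbTE ky).
by case: (x == y) => //; rewrite eq_sym.
Qed.

(** The divisor 'X_x - 'X_k stays nonzero modulo 'X_y - 'X_z when [k] is neither [y] nor [z], so it
    can be cancelled after reduction. *)
Lemma coll_quo y z x k P Q : x != k -> k != y -> k != z ->
  coll x k P = 0 -> coll x k Q = 0 -> coll y z P = coll y z Q ->
  coll y z (quo x k P) = coll y z (quo x k Q).
Proof.
move=> xk ky kz eP eQ e; apply: (mulfI (coll_sub_neq0 y z x k xk ky kz)).
by rewrite -!collM !quoE.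
Qed.

(* The Goresky-Kottwitz-MacPherson congruences on the permutohedral variety. *)
Definition gkm s f : Prop := forall l x y r, perm_eq (l ++ [:: x, y & r]) s ->
  coll x y (f (l ++ [:: x, y & r])) = coll x y (f (l ++ [:: y, x & r])).

Lemma gkm_cons x s f : gkm (x :: s) f -> gkm s (fun w => f (x :: w)).
Proof. by move=> h l y z r e; apply: (h (x :: l)); rewrite perm_cons. Qed.

Lemma gkm_perm s s' f : perm_eq s s' -> gkm s f -> gkm s' f.
Proof. by move=> e h l x y r e'; apply: h; rewrite (perm_trans e') // perm_sym. Qed.

Lemma gkm_cons2 x k w f : gkm [:: k, x & w] f -> gkm (k :: w) (fun v => f (x :: v)).
Proof.
by move=> h; apply: gkm_cons; apply: gkm_perm h; apply/permPl/(perm_catCA [:: k] [:: x] w).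
Qed.

Lemma coll_swap x y P Q : coll x y P = coll x y Q -> coll x y (P - Q) = 0.
Proof. by move=> e; rewrite collB e subrr. Qed.

(** The polynomial form of [tel]: the congruences make every difference divisible by 'X_x - 'X_k,
    and [quo] carries out the division. *)
Fixpoint poly_tel k f w : A :=
  if w is x :: w' then
    'X_x * quo x k (f [:: x, k & w'] - f [:: k, x & w']) + poly_tel k (fun v => f (x :: v)) w'
  else 0.

Lemma poly_tel_cons k f x w : poly_tel k f (x :: w) =
  'X_x * quo x k (f [:: x, k & w] - f [:: k, x & w]) + poly_tel k (fun v => f (x :: v)) w.
Proof. by []. Qed.

Lemma gkm_head k x w f : gkm [:: k, x & w] f ->
  coll x k (f [:: x, k & w] - f [:: k, x & w]) = 0.
Proof.
move=> h; apply: coll_swap; apply: (h [::]) => /=.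
exact/permPl/(perm_catCA [:: x] [:: k] w).
Qed.

Lemma tel_poly_tel k f w : k \notin w -> gkm (k :: w) f ->
  tel T k (fun v => tofrac (f v)) w = tofrac (poly_tel k f w).
Proof.
elim: w f => [|x w IH] f /=; first by rewrite tofrac0.
rewrite inE negb_or eq_sym => /andP[xk kw] h.
rewrite (IH (fun v => f (x :: v))) //; last exact: gkm_cons2.
rewrite tofracD; congr (_ + _).
have -> : tofrac (f [:: x, k & w]) - tofrac (f [:: k, x & w]) =
    (T x - T k) * tofrac (quo x k (f [:: x, k & w] - f [:: k, x & w])).
  by rewrite /tvar -tofracB -[tofrac 'X_x - _]tofracB -tofracM quoE // gkm_head.
by rewrite mulrA divfK ?tofracM // diff_neq0 //; exact: tvar_inj.
Qed.

Lemma coll_poly_tel y z k w f g : k \notin w -> k != y -> k != z ->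
  gkm (k :: w) f -> gkm (k :: w) g ->
  (forall v, perm_eq v (k :: w) -> coll y z (f v) = coll y z (g v)) ->
  coll y z (poly_tel k f w) = coll y z (poly_tel k g w).
Proof.
elim: w f g => [|x w IH] f g //; rewrite inE negb_or eq_sym => /andP[xk kw] ky kz hf hg e.
have pe : perm_eq [:: x, k & w] [:: k, x & w] by exact/permPl/(perm_catCA [:: x] [:: k] w).
rewrite !poly_tel_cons !collD !collM (IH (fun v => f (x :: v)) (fun v => g (x :: v))) //.
- by rewrite (coll_quo y z x k _ (g [:: x, k & w] - g [:: k, x & w])) ?gkm_head // !collB !e.
- exact: gkm_cons2.
- exact: gkm_cons2.
by move=> v hv; apply: e; rewrite (perm_trans _ pe) // perm_cons.
Qed.

(** Both d (q1 + q2) and d (q3 + q4) equal a - e; the intermediate values [b] and [b'] drop out. *)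
Lemma exchange_identity (D : idomainType) (d c q1 q2 q3 q4 a b b' e t : D) : d != 0 ->
  d * q1 = b - e -> d * q2 = a - b -> d * q3 = b' - e -> d * q4 = a - b' ->
  c * q1 + (c * q2 + t) = c * q3 + (c * q4 + t).
Proof.
move=> d0 e1 e2 e3 e4; apply: (mulfI d0).
transitivity (c * (d * q1 + d * q2) + d * t); first by ring.
rewrite e1 e2 (_ : b - e + (a - b) = b' - e + (a - b')); last by ring.
by rewrite -e3 -e4; ring.
Qed.

(** The critical terms are those where [k] passes [y] and [z]. Modulo 'X_y - 'X_z both divisors
    become 'X_z - 'X_k, and the two terms add up to the passage of [k] from before the pair to after
    it. At these two extremes the congruences for [f] apply; the values with [k] between [y] and [z]
    need not agree, but they cancel. *)
Lemma poly_tel_swap k l y z r f : uniq (k :: l ++ [:: y, z & r]) ->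
  gkm (k :: l ++ [:: y, z & r]) f ->
  coll y z (poly_tel k f (l ++ [:: y, z & r])) = coll y z (poly_tel k f (l ++ [:: z, y & r])).
Proof.
elim: l f => [|x l IH] f.
  rewrite !cat0s [uniq _]/= !inE !negb_or => /and4P[/and3P[ky kz kr] /andP[yz yr] zr ur] h.
  have yk : y != k by rewrite eq_sym.
  have zk : z != k by rewrite eq_sym.
  have hs : gkm [:: k, z, y & r] f.
    by apply: gkm_perm h; rewrite perm_cons; exact/permPl/(perm_catCA [:: y] [:: z] r).
  have hy := gkm_cons2 _ _ _ _ h; have hz := gkm_cons2 _ _ _ _ hs.
  have tail : coll y z (poly_tel k (fun v => f [:: y, z & v]) r) =
      coll y z (poly_tel k (fun v => f [:: z, y & v]) r).
    apply: coll_poly_tel => //; [exact: (gkm_cons2 z k r (fun v => f (y :: v)))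
                                |exact: (gkm_cons2 y k r (fun v => f (z :: v)))|move=> v hv].
    apply: (h [::] y z v); apply: (@perm_trans _ [:: y, z, k & r]); first by rewrite !perm_cons.
    by apply/permPl/(perm_catCA [:: y; z] [:: k] r).
  have e U V : coll y k (U - V) = 0 ->
     coll y z ('X_z - 'X_k) * coll y z (quo y k (U - V)) = coll y z U - coll y z V.
    move=> e; rewrite -collB -[in RHS](quoE _ _ _ e) collM !collB !collX /identify eqxx.
    by case: (z == y).
  have e' U V : coll z k (U - V) = 0 ->
     coll y z ('X_z - 'X_k) * coll y z (quo z k (U - V)) = coll y z U - coll y z V.
    by move=> e0; rewrite -collB -[in RHS](quoE _ _ _ e0) collM.
  have exy : coll y z 'X_y = coll y z 'X_z by rewrite !collX /identify eqxx; case: (z == y).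
  have top : coll y z (f [:: y, z, k & r]) = coll y z (f [:: z, y, k & r]).
    apply: (h [::] y z (k :: r)); exact/permPl/(perm_catCA [:: y; z] [:: k] r).
  have bot := h [:: k] y z r (perm_refl _); rewrite /= in bot.
  rewrite !poly_tel_cons !collD !collM exy tail.
  have q1 := e _ _ (gkm_head _ _ _ _ h); have q2 := e' _ _ (gkm_head _ _ _ _ hy).
  have q3 := e' _ _ (gkm_head _ _ _ _ hs); have q4 := e _ _ (gkm_head _ _ _ _ hz).
  rewrite bot in q1; rewrite top in q2.
  exact: (exchange_identity _ _ _ _ _ _ _ _ _ _ _ _ (coll_sub_neq0 y z z k zk ky kz) q1 q2 q3 q4).
rewrite [uniq _]/= inE negb_or => /and3P[/andP[kx kl] xl ul] h.
have pe : perm_eq [:: x, k & l ++ [:: y, z & r]] [:: k, x & l ++ [:: y, z & r]].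
  exact/permPl/(perm_catCA [:: x] [:: k]).
have ps : perm_eq (l ++ [:: z, y & r]) (l ++ [:: y, z & r]).
  by rewrite perm_cat2l; exact/permPl/(perm_catCA [:: z] [:: y]).
have [ky kz] : k != y /\ k != z.
  by move: kl; rewrite mem_cat !inE !negb_or => /and4P[].
rewrite !cat_cons !poly_tel_cons !collD !collM (IH (fun v => f (x :: v))).
- rewrite (coll_quo y z x k _ (f [:: x, k & l ++ [:: z, y & r]] - f [:: k, x & l ++ [:: z, y & r]])) //.
  + by rewrite eq_sym.
  + exact: gkm_head.
  + by apply: gkm_head; apply: gkm_perm h; rewrite !perm_cons perm_sym.
  + by rewrite !collB (h [:: x, k & l]) // (h [:: k, x & l]).
- by rewrite /= kl.
- exact: gkm_cons2.
Qed.

Lemma gkm_polynomial s f : uniq s -> gkm s f ->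
  exists P, \sum_(w <- orders s) chain_series T w * tofrac (f w) = tofrac P.
Proof.
elim: s f => [|k s IH] f us h.
  by exists (f [::]); rewrite /= big_seq1 mul1r.
have hg : gkm s (fun w => f (k :: w) + poly_tel k f w).
  move=> l x y r e; rewrite !collD (h (k :: l)) ?perm_cons // poly_tel_swap //.
    by rewrite (perm_uniq (s2 := k :: s)) // perm_cons.
  by apply: gkm_perm h; rewrite perm_cons perm_sym.
move: us => /= /andP[ks us]; have [P eP] := IH _ us hg.
exists P; rewrite -eP big_orders_cons; apply: eq_big_seq => w /orders_perm e.
have kw : k \notin w by rewrite (perm_mem e).
rewrite inserts_sum ?(perm_uniq e) //; last exact: tvar_inj.
by rewrite tel_poly_tel ?tofracD //; apply: gkm_perm h; rewrite perm_cons perm_sym.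
Qed.

End GKM.

(** * Characters at the fixed points *)

Section LinearFactors.
Context {I : finType} {K L : comNzRingType} (g : {rmorphism K -> L}).
Implicit Types (P : pred I) (F : I -> K).

Lemma map_prod_addX P F :
  map_poly g (\prod_(i | P i) ('X + (F i)%:P)) = \prod_(i | P i) ('X + (g (F i))%:P).
Proof.
by rewrite rmorph_prod; apply: eq_bigr => i _; rewrite rmorphD /= map_polyC map_polyX.
Qed.

Lemma map_prod_add1 P F :
  map_poly g (\prod_(i | P i) (1 + (F i)%:P * 'X)) = \prod_(i | P i) (1 + (g (F i))%:P * 'X).
Proof.
rewrite rmorph_prod; apply: eq_bigr => i _.
by rewrite rmorphD rmorphM rmorph1 /= map_polyC map_polyX.
Qed.

Lemma coef_map_poly (p : {poly K}) k : g (p`_k) = (map_poly g p)`_k.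
Proof. by rewrite coef_map. Qed.

End LinearFactors.

Lemma prod_addX_inv (I : finType) (K : fieldType) (P : pred I) (t : I -> K) :
  (forall i, t i != 0) -> \prod_(i | P i) ('X + (t i)%:P) =
  (\prod_(i | P i) t i)%:P * \prod_(i | P i) (1 + (t i)^-1%:P * 'X).
Proof.
move=> t0; rewrite rmorph_prod -big_split; apply: eq_bigr => i _ /=.
by rewrite mulrDr mulr1 mulrA -polyCM mulfV // mul1r addrC.
Qed.

Section Characters.
Context {n : nat}.
Local Notation A := {mpoly rat[n]}.
Implicit Types (V W : trep n) (w : 'rV[int]_n) (S : {set 'I_n}).

Lemma tvar_neq0 (i : 'I_n) : tvar i != 0.
Proof.
rewrite tofrac_eq0; apply/eqP => /(congr1 (mcoeff U_(i))).
by rewrite mcoeffX eqxx mcoeff0 => /eqP; rewrite oner_eq0.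
Qed.

Lemma tmonD w1 w2 : tmon (w1 + w2) = tmon w1 * tmon w2.
Proof.
by rewrite -big_split; apply: eq_bigr => i _; rewrite mxE expfzDr // tvar_neq0.
Qed.

Lemma tmon0 : tmon (0 : 'rV[int]_n) = 1.
Proof. by rewrite /tmon big1 // => i _; rewrite mxE. Qed.

Lemma tmonN w : tmon (- w) = (tmon w)^-1.
Proof. by rewrite /tmon -prodfV; apply: eq_bigr => i _; rewrite mxE invr_expz. Qed.

Lemma tmon_sum (I : Type) (r : seq I) (P : pred I) (f : I -> 'rV[int]_n) :
  tmon (\sum_(i <- r | P i) f i) = \prod_(i <- r | P i) tmon (f i).
Proof. exact: (big_morph _ tmonD tmon0). Qed.

Lemma tmon_delta (i : 'I_n) : tmon (delta_mx 0 i) = tvar i.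
Proof.
rewrite /tmon (bigD1 i) //= !mxE !eqxx big1 ?mulr1 // => j ji.
by rewrite mxE (negbTE ji).
Qed.

(** The weights of an exterior power are the sums over subsets of size [p], which are also what the
    expansion of the product collects in degree [p]. *)
Lemma rep_char_ext p V :
  rep_char (rep_ext p V) = (\prod_(w <- V) (1 + (tmon w)%:P * 'X))`_p.
Proof.
rewrite /rep_char /rep_ext big_map big_enum /= (big_nth 0) big_mkord.
under [in RHS]eq_bigr => i _ do rewrite addrC.
rewrite bigA_distr coef_sum [LHS](eq_bigl (fun B : {set 'I_(size V)} => #|B| == p)); last first.
  by move=> B; rewrite inE.
rewrite big_mkcond; apply: eq_bigr => B _.
rewrite -big_mkcond big_split /= prodr_const -rmorph_prod /= coefCM coefXn eq_sym.
by rewrite tmon_sum; case: eqP => _; rewrite ?mulr1 ?mulr0.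
Qed.

Lemma rep_detE V : rep_det V = [:: \sum_(w <- V) w].
Proof.
rewrite /rep_det /rep_ext.
have -> : enum [set B : {set 'I_(size V)} | #|B| == size V] = [:: setT].
  rewrite -enum_set1; apply: eq_enum => B; rewrite !inE.
  have hB : (#|B| <= size V)%N by have := max_card B; rewrite card_ord.
  by rewrite eqEcard subsetT cardsT card_ord /= eqn_leq hB.
rewrite /=; congr [:: _]; rewrite (big_nth 0) big_mkord.
by apply: eq_bigl => i; rewrite inE.
Qed.

Lemma O11_class (S : set_flag n) : bundle_class (@O11 n) S = tset S.1 * tset S.2.
Proof.
have e (B : {set 'I_n}) : tmon (- \sum_(w <- rep_coord B) w) = tset B.
  rewrite big_map big_enum /= -sumrN tmon_sum; apply: eq_bigr => i _.
  by rewrite opprK tmon_delta.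
by rewrite /bundle_class /rep_char /O11 !rep_detE /= big_seq1 tmonD !e.
Qed.

Lemma ext_taut2_class p (S : set_flag n) :
  bundle_class (ext_taut2 (n := n) p) S = (\prod_(i in S.2) (1 + (tvar i)^-1%:P * 'X))`_p.
Proof.
have e : \prod_(w <- rep_coord S.2) (1 + (tmon w)%:P * 'X) =
    \prod_(i in S.2) (1 + (tvar i)^-1%:P * 'X).
  by rewrite big_map big_enum /=; apply: eq_bigr => i _; rewrite tmonN tmon_delta.
by rewrite -e -rep_char_ext.
Qed.

Lemma ext_quot1_dual_class q (S : set_flag n) :
  bundle_class (ext_quot1_dual (n := n) q) S = (\prod_(i in ~: S.1) (1 + (tvar i)%:P * 'X))`_q.
Proof.
have e : \prod_(w <- rep_dual (rep_coord (~: S.1))) (1 + (tmon w)%:P * 'X) =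
    \prod_(i in ~: S.1) (1 + (tvar i)%:P * 'X).
  by rewrite !big_map big_enum /=; apply: eq_bigr => i _; rewrite opprK tmon_delta.
by rewrite -e -rep_char_ext.
Qed.

Lemma cotangent_euler_neq0 (S : set_flag n) : cotangent_euler S != 0.
Proof.
apply/prodf_neq0 => -[i j]; rewrite inE /= => h.
have ij : j != i by case/orP: h => /andP[h1]; apply: contraNneq => ->.
rewrite subr_eq0 eq_sym -(inj_eq (mulfI (tvar_neq0 i))) mulr1 mulVKf ?tvar_neq0 //.
by rewrite (inj_eq tvar_inj).
Qed.

(* The coefficient of u^p v^q contributed by B: picking 'X in a factor of the second
   product leaves that element of B_2 out of the subset. *)
Definition flag_poly p q (B : set_flag n) : A :=
  (\prod_(i in B.1) 'X_i) * (\prod_(i in B.2) ('X + ('X_i)%:P))`_p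
    * (\prod_(i in ~: B.1) (1 + ('X_i)%:P * 'X))`_q.

(** The second determinant in O(1,1) contributes the t_i with i in B_2; they turn each factor 1 +
    t_i^-1 X into X + t_i, which removes all negative powers. *)
Lemma flag_polyE p q B :
  tofrac (flag_poly p q B) = bundle_class (@O11 n) B
    * bundle_class (ext_taut2 (n := n) p) B * bundle_class (ext_quot1_dual (n := n) q) B.
Proof.
have e1 := map_prod_addX (@tofrac A) (fun i => i \in B.2) (fun i => 'X_i).
have e2 := map_prod_add1 (@tofrac A) (fun i => i \in ~: B.1) (fun i => 'X_i).
rewrite (prod_addX_inv _ _ _ _ tvar_neq0) in e1.
rewrite O11_class ext_taut2_class ext_quot1_dual_class /flag_poly.
rewrite !tofracM !coef_map_poly e1 e2 coefCM mulrA rmorph_prod.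
by [].
Qed.

End Characters.

Section GreedySwap.
Context {n : nat}.
Implicit Types (M : matroid n) (A : {set 'I_n}) (x y i : 'I_n) (l r w : seq 'I_n).

Lemma greedy_prod_cons M (K : comNzRingType) (G H : 'I_n -> K) A x w : x \notin w ->
  \prod_(i <- x :: w) (if i \in greedy M A (x :: w) then G i else H i) =
  (if (rk M A < rk M (x |: A))%N then G x else H x)
    * \prod_(i <- w) (if i \in greedy M (x |: A) w then G i else H i).
Proof.
move=> xw; rewrite big_cons /=.
have xg : x \notin greedy M (x |: A) w by apply: contra xw => /greedy_sub.
congr (_ * _); first by case: (_ < _)%N; rewrite ?setU11 ?(negbTE xg).
apply: eq_big_seq => i iw; case: (_ < _)%N => //; rewrite in_setU1.
by have [e|] := eqVneq i x; first by rewrite -e iw in xw.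
Qed.

(** Exchanging two neighbours does not affect what is kept elsewhere, and by [jump_swap] the number
    of elements kept among the two is the same. *)
Lemma greedy_prod_swap M (K : comNzRingType) (G H : 'I_n -> K) A l x y r :
  uniq (l ++ [:: x, y & r]) -> G x = G y -> H x = H y ->
  \prod_(i <- l ++ [:: x, y & r]) (if i \in greedy M A (l ++ [:: x, y & r]) then G i else H i) =
  \prod_(i <- l ++ [:: y, x & r]) (if i \in greedy M A (l ++ [:: y, x & r]) then G i else H i).
Proof.
move=> u eG eH; elim: l A u => [|z l IH] A u.
  move: u => /= /and3P[]; rewrite inE negb_or => /andP[xy xr] yr ur.
  rewrite !greedy_prod_cons ?inE ?negb_or ?xy ?yr ?xr // 1?eq_sym ?xy //.
  rewrite !mulrA [y |: (x |: A)]setUCA; congr (_ * _).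
  have := jump_swap M A x y; rewrite [y |: (x |: A)]setUCA -eG -eH.
  do 4!case: (_ < _)%N => //=; by rewrite mulrC.
move: u => /= /andP[zn u].
have zn' : z \notin l ++ [:: y, x & r].
  rewrite (perm_mem (s2 := l ++ [:: x, y & r])) // perm_cat2l.
  exact/permPl/(perm_catCA [:: y] [:: x] r).
by have := greedy_prod_cons M K G H A z _ zn; have := greedy_prod_cons M K G H A z _ zn';
  move=> /= -> ->; rewrite IH.
Qed.

End GreedySwap.

Section Regularity.
Context {n : nat} (M : flag_matroid n).
Local Notation A := {mpoly rat[n]}.

(** Each factor is a product over a greedy basis or its complement, or a coefficient of one. Modulo
    'X_x - 'X_y its factors at [x] and [y] coincide, and [greedy_prod_swap] applies. *)
Lemma flag_poly_gkm p q : gkm (enum 'I_n) (fun w => flag_poly p q (gflag M w)).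
Proof.
move=> l x y r e; set w1 := l ++ _; set w2 := l ++ [:: y, x & r].
have u1 : uniq w1 by rewrite (perm_uniq e) enum_uniq.
have h1 i : i \in w1 by rewrite (perm_mem e) mem_enum.
have e12 : perm_eq w2 w1 by rewrite perm_cat2l; exact/permPl/(perm_catCA [:: y] [:: x] r).
have u2 : uniq w2 by rewrite (perm_uniq e12).
have h2 i : i \in w2 by rewrite (perm_mem e12).
have full (K : comNzRingType) w (F : 'I_n -> K) : uniq w -> (forall i, i \in w) ->
    \prod_(i <- w) F i = \prod_i F i.
  by move=> uw hw; rewrite big_uniq //; apply: eq_bigl.
have key (K : comNzRingType) (N : matroid n) (G H : 'I_n -> K) : G x = G y -> H x = H y ->
    \prod_i (if i \in greedy N set0 w1 then G i else H i) =
    \prod_i (if i \in greedy N set0 w2 then G i else H i).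
  move=> eG eH; rewrite -(full _ w1) // -(full _ w2) //; exact: greedy_prod_swap.
have keyG (K : comNzRingType) (N : matroid n) (G : 'I_n -> K) : G x = G y ->
    \prod_(i in greedy N set0 w1) G i = \prod_(i in greedy N set0 w2) G i.
  by move=> eG; rewrite !(big_mkcond (fun i => i \in greedy _ _ _)); exact: key.
have keyH (K : comNzRingType) (N : matroid n) (G : 'I_n -> K) : G x = G y ->
    \prod_(i in ~: greedy N set0 w1) G i = \prod_(i in ~: greedy N set0 w2) G i.
  move=> eG; have := key K N (fun=> 1) G erefl eG.
  rewrite !(big_mkcond (fun i => i \in ~: _)) /= => h; etransitivity; last etransitivity; [|exact: h|];
    by apply: eq_bigr => i _; rewrite inE; case: (_ \in _).
have exy : coll x y 'X_x = coll x y 'X_y.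
  rewrite !collX /identify; by rewrite eqxx; case: (y == x).
have e1 B := map_prod_addX (coll x y) (fun i => i \in B) (fun i => 'X_i).
have e2 B := map_prod_add1 (coll x y) (fun i => i \in ~: B) (fun i => 'X_i).
have a1 : coll x y (\prod_(i in (gflag M w1).1) 'X_i) = coll x y (\prod_(i in (gflag M w2).1) 'X_i).
  rewrite !(rmorph_prod (coll x y)); exact: (keyG _ _ (fun i => coll x y 'X_i)).
have a2 : coll x y (\prod_(i in (gflag M w1).2) ('X + ('X_i)%:P))`_p =
    coll x y (\prod_(i in (gflag M w2).2) ('X + ('X_i)%:P))`_p.
  rewrite (coef_map_poly (coll x y)) [RHS](coef_map_poly (coll x y)) !e1.
  congr (polyseq _)`_p; apply: (keyG {poly A} (fm2 M) (fun i => 'X + (coll x y 'X_i)%:P)).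
  by rewrite exy.
have a3 : coll x y (\prod_(i in ~: (gflag M w1).1) (1 + ('X_i)%:P * 'X))`_q =
    coll x y (\prod_(i in ~: (gflag M w2).1) (1 + ('X_i)%:P * 'X))`_q.
  rewrite (coef_map_poly (coll x y)) [RHS](coef_map_poly (coll x y)) !e2.
  congr (polyseq _)`_q; apply: (keyH {poly A} (fm1 M) (fun i => 1 + (coll x y 'X_i)%:P * 'X)).
  by rewrite exy.
by rewrite /flag_poly collM [RHS]collM collM a1 a2 a3 -collM.
Qed.

End Regularity.

(** * Localization as a sum over orders *)

Section Assembly.
Context {R : realFieldType} {n : nat} (M : flag_matroid n).
Local Notation A := {mpoly rat[n]}.
Local Notation r1 := (rk (fm1 M) [set: 'I_n]).
Local Notation r2 := (rk (fm2 M) [set: 'I_n]).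

(** The product of cotangent weights in [yclass] cancels the denominator of the localization
    formula. Every order has exactly one greedy flag, so the sums over flags and over their orders
    merge. *)
Lemma KT_coefE p q : KT_coef R M p q =
  \sum_(w <- orders (enum 'I_n)) chain_series (@tvar n) w * tofrac (flag_poly p q (gflag M w)).
Proof.
transitivity (\sum_(B in flag_bases M) hilb (tangent_cone (R := R) M B) * tofrac (flag_poly p q B)).
  rewrite /KT_coef /chiT [RHS]big_mkcond [LHS]big_mkcond; apply: eq_bigr => B _.
  rewrite /yclass; case hB: (B \in flag_bases M); last by rewrite !mul0r; case: ifP.
  have -> : B \in coord_flags n r1 r2.
    move: hB; rewrite !inE !basisE => /and3P[/andP[_ h1] /andP[_ h2] h3].
    by apply/and3P.
  rewrite flag_polyE -!mulrA; congr (_ * _).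
  by rewrite mulrC -!mulrA mulVf ?cotangent_euler_neq0 ?mulr1.
under eq_bigr => B hB do rewrite hilb_tangent_cone // big_mkcond mulr_suml.
rewrite exchange_big; apply: eq_big_seq => w /orders_perm e.
have hw : gflag M w \in flag_bases M.
  by apply: gflag_basis => i; rewrite (perm_mem e) mem_enum.
rewrite (bigD1 (gflag M w)) //= eqxx big1 ?addr0 // => B /andP[_ hB].
by rewrite eq_sym (negbTE hB) mul0r.
Qed.

Lemma KT_coef_polynomial p q : exists P : A, KT_coef R M p q == tofrac P.
Proof.
have [P e] := gkm_polynomial _ _ (enum_uniq 'I_n) (flag_poly_gkm M p q).
by exists P; rewrite KT_coefE e.
Qed.

End Assembly.

(** * Specializations *)

Section Bivariate.
Context (a b : nat).

Definition bipoly {K : nzRingType} (c : nat -> nat -> K) : {poly {poly K}} :=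
  \sum_(p < a) \sum_(q < b) (c p q)%:P%:P * ('X - 1) ^+ p * ('Y - 1) ^+ q.

Lemma map_bipoly (K L : nzRingType) (g : {rmorphism K -> L}) c :
  map_poly (map_poly g) (bipoly c) = bipoly (fun p q => g (c p q)).
Proof.
rewrite rmorph_sum; apply: eq_bigr => p _; rewrite rmorph_sum; apply: eq_bigr => q _.
rewrite !rmorphM !rmorphXn !rmorphB /= !rmorph1 map_polyX.
by rewrite !map_polyC /= !map_polyC map_polyX.
Qed.

Lemma horner_bipoly (K : comNzRingType) (c : nat -> nat -> K) x y :
  (bipoly c).[x, y] = \sum_(p < a) \sum_(q < b) c p q * (x - 1) ^+ p * (y - 1) ^+ q.
Proof.
rewrite !horner_sum; apply: eq_bigr => p _; rewrite !horner_sum; apply: eq_bigr => q _.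
by rewrite !hornerE.
Qed.

End Bivariate.

Section QField.
Context {F : fieldType}.

Lemma const_q_is_zmod_morphism : zmod_morphism (@const_q F).
Proof. by move=> x y; rewrite /const_q /= polyCB rmorphB. Qed.

Lemma const_q_is_monoid_morphism : monoid_morphism (@const_q F).
Proof. by split=> [|x y]; rewrite /const_q /= ?rmorph1 // polyCM rmorphM. Qed.

HB.instance Definition _ := GRing.isZmodMorphism.Build F {fraction {poly F}}
  (@const_q F) const_q_is_zmod_morphism.
HB.instance Definition _ := GRing.isMonoidMorphism.Build F {fraction {poly F}}
  (@const_q F) const_q_is_monoid_morphism.

Lemma qvar_neq0 : qvar F != 0.
Proof. by rewrite tofrac_eq0 polyX_eq0. Qed.

Lemma horner_const_q (p : {poly F}) : (map_poly (@const_q F) p).[qvar F] = tofrac p.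
Proof.
rewrite (map_poly_comp (@tofrac {poly F}) polyC) horner_map /=.
by rewrite -[_.['X]]/(p \Po 'X) comp_polyXr.
Qed.

End QField.

Lemma tofrac_injective (D : idomainType) : injective (@tofrac D).
Proof. by move=> x y /eqP; rewrite tofrac_eq => /eqP. Qed.

(** * The identity under ring maps from polynomials to a field *)

Section FieldIdentity.
Context {R : realFieldType} {n : nat} (M : flag_matroid n).
Local Notation A := {mpoly rat[n]}.
Local Notation r1 := (rk (fm1 M) [set: 'I_n]).
Local Notation r2 := (rk (fm2 M) [set: 'I_n]).

Lemma horner_prod_addX (K : fieldType) (B : {set 'I_n}) (t : 'I_n -> K) (q : K) : q != 0 ->
  (\prod_(i in B) ('X + (t i)%:P)).[q^-1] = q ^- #|B| * \prod_(i in B) (1 + q * t i).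
Proof.
move=> q0; rewrite horner_prod -exprVn -prodr_const -big_split; apply: eq_bigr => i _ /=.
by rewrite !hornerE mulrDr mulr1 mulKf.
Qed.

Lemma horner_prod_add1 (K : fieldType) (B : {set 'I_n}) (t : 'I_n -> K) (q : K) :
  (\prod_(i in B) (1 + (t i)%:P * 'X)).[q] = \prod_(i in B) (1 + q * t i).
Proof.
by rewrite horner_prod; apply: eq_bigr => i _; rewrite !hornerE mulrC.
Qed.

Lemma size_prod_linear (K : comNzRingType) (B : {set 'I_n}) (f : 'I_n -> {poly K}) :
  (forall i, (size (f i) <= 2)%N) -> (size (\prod_(i in B) f i)%R <= #|B|.+1)%N.
Proof.
move=> h; apply: leq_trans (size_prod_leq _ _) _.
have : (\sum_(i in B) size (f i) <= #|B| * 2)%N.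
  by rewrite -sum_nat_const leq_sum.
rewrite [X in (_ - X)%N](_ : _ = #|B|); last by apply: eq_card.
by move: (\sum_(i in B) _)%N => s; rewrite muln2 -addnn; lia.
Qed.

(** The summation bounds exceed the degrees of the two products, so the double sum evaluates them at
    q^-1 and q. As B_1 is contained in B_2, the factors over B_2 and over the complement of B_1
    cover every index once and those of B_2 outside B_1 a second time. *)
Lemma flag_poly_sum (K : fieldType) (g : {rmorphism A -> K}) (q : K) (B : set_flag n) :
  q != 0 -> B \in flag_bases M ->
  \sum_(p < r2.+1) \sum_(k < (n - r1).+1) g (flag_poly p k B) * q^-1 ^+ p * q ^+ k =
  q ^- r2 * \prod_i (1 + q * g 'X_i)
    * ((\prod_(i in B.1) g 'X_i) * \prod_(i in B.2 :\: B.1) (1 + q * g 'X_i)).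
Proof.
move=> q0; rewrite inE !basisE => /and3P[/andP[_ /eqP c1] /andP[_ /eqP c2] s12].
pose P := \prod_(i in B.2) ('X + (g 'X_i)%:P).
pose Q := \prod_(i in ~: B.1) (1 + (g 'X_i)%:P * 'X).
have gE p k : g (flag_poly p k B) = (\prod_(i in B.1) g 'X_i) * P`_p * Q`_k.
  by rewrite /flag_poly !rmorphM !coef_map_poly map_prod_addX map_prod_add1 rmorph_prod.
have sP : (size P <= r2.+1)%N.
  by rewrite -c2; apply: size_prod_linear => i; rewrite size_XaddC.
have sQ : (size Q <= (n - r1).+1)%N.
  have -> : (n - r1)%N = #|~: B.1| by rewrite cardsCs setCK card_ord c1.
  apply: size_prod_linear => i; rewrite addrC mul_polyC.
  apply: leq_trans (size_polyD _ _) _; rewrite size_poly1 geq_max andbT.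
  by rewrite (leq_trans (size_scale_leq _ _)) ?size_polyX.
transitivity ((\prod_(i in B.1) g 'X_i) * P.[q^-1] * Q.[q]).
  rewrite (horner_coef_wide _ sP) (horner_coef_wide _ sQ) -mulrA mulr_suml mulr_sumr.
  apply: eq_bigr => p _; rewrite !mulr_sumr; apply: eq_bigr => k _; rewrite gE.
  move: (q^-1 ^+ p) (q ^+ k) P`_p Q`_k (\prod_(i in B.1) _) => x y u v z; ring.
rewrite horner_prod_addX // horner_prod_add1 c2.
rewrite (bigID (fun i => i \in B.1) (fun i => i \in B.2)) /=.
rewrite (bigID (fun i => i \in B.1) xpredT) /=.
have -> : \prod_(i in B.2 | i \in B.1) (1 + q * g 'X_i) = \prod_(i in B.1) (1 + q * g 'X_i).
  apply: eq_bigl => i; have := subsetP s12 i; by case: (i \in B.1) => [->|]; rewrite ?andbF.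
have -> : \prod_(i in B.2 | i \notin B.1) (1 + q * g 'X_i)
    = \prod_(i in B.2 :\: B.1) (1 + q * g 'X_i) by apply: eq_bigl => i; rewrite !inE andbC.
have -> : \prod_(i in ~: B.1) (1 + q * g 'X_i) = \prod_(i | i \notin B.1) (1 + q * g 'X_i).
  by apply: eq_bigl => i; rewrite !inE.
set x := \prod_(i in B.1) g 'X_i; set y := \prod_(i in B.1) (1 + q * g 'X_i).
set z := \prod_(i in _ :\: _) _; set u := \prod_(i | i \notin B.1) _.
by move: x y z u (q ^- r2) => x y z u v; ring.
Qed.

Context (N : nat -> nat -> A).
Context (hN : forall p k, KT_coef R M p k = tofrac (N p k)).

(** All four conclusions come from instances: [g] embeds the polynomials or evaluates them at t = 1,
    and [q] is the variable or 1. *)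
Definition specialized {K : fieldType} (g : {rmorphism A -> K}) (q : K) : Prop :=
  \sum_(p < r2.+1) \sum_(k < (n - r1).+1) g (N p k) * q^-1 ^+ p * q ^+ k =
  q ^- (r1 + r2) * \prod_i (1 + g 'X_i * q)
    * \sum_(S in pseudo_bases M) (\prod_(i in S) g 'X_i) * q ^+ #|S|.

Lemma chain_series_map (K L : fieldType) (g : {rmorphism K -> L}) (t : 'I_n -> K) w :
  g (chain_series t w) = chain_series (fun i => g (t i)) w.
Proof.
elim: w => [|x w IH] /=; first by rewrite rmorph1.
by rewrite rmorphM IH; case: w {IH} => [|y w]; rewrite ?rmorph1 // fmorph_div rmorphB.
Qed.

Lemma exchange_triple (K : comNzRingType) (W : Type) (r : seq W) (H : W -> K)
    (f : nat -> nat -> W -> K) (x y : nat -> K) (a b : nat) :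
  \sum_(p < a) \sum_(k < b) (\sum_(w <- r) H w * f p k w) * x p * y k =
  \sum_(w <- r) H w * \sum_(p < a) \sum_(k < b) f p k w * x p * y k.
Proof.
under eq_bigr => p _ do under eq_bigr => k _ do rewrite !mulr_suml.
under eq_bigr => p _ do rewrite exchange_big /=.
rewrite exchange_big /=; apply: eq_bigr => w _.
rewrite mulr_sumr; apply: eq_bigr => p _; rewrite mulr_sumr; apply: eq_bigr => k _.
by rewrite !mulrA.
Qed.

Lemma specialized_chain (K : fieldType) (g : {rmorphism A -> K}) (q : K) : q != 0 ->
  injective (fun i => g 'X_i) ->
  (forall p k, g (N p k) = \sum_(w <- orders (enum 'I_n))
     chain_series (fun i => g 'X_i) w * g (flag_poly p k (gflag M w))) ->
  specialized g q.
Proof.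
move=> q0 tI gN; rewrite /specialized; set t := fun i => g 'X_i in tI gN *.
transitivity (\sum_(w <- orders (enum 'I_n)) chain_series t w *
   \sum_(p < r2.+1) \sum_(k < (n - r1).+1) g (flag_poly p k (gflag M w)) * q^-1 ^+ p * q ^+ k).
  rewrite -(exchange_triple _ _ _ (chain_series t) (fun p k w => g (flag_poly p k (gflag M w)))
    (fun p => q^-1 ^+ p) (fun k => q ^+ k)); apply: eq_bigr => p _; apply: eq_bigr => k _; by rewrite gN.
transitivity (\sum_(w <- orders (enum 'I_n)) q ^- r2 * \prod_i (1 + q * t i) * (chain_series t w *
   ((\prod_(i in (gflag M w).1) t i) * \prod_(i in (gflag M w).2 :\: (gflag M w).1) (1 + q * t i)))).
  apply: eq_big_seq => w /orders_perm e; rewrite flag_poly_sum //; first by rewrite mulrCA.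
  by apply: gflag_basis => i; rewrite (perm_mem e) mem_enum.
rewrite -mulr_sumr (greedy_sum M t q tI q0 (enum 'I_n) (enum_uniq _)) => [|i]; last by rewrite mem_enum.
have -> : \prod_i (1 + q * t i) = \prod_i (1 + g 'X_i * q) by apply: eq_bigr => i _; rewrite mulrC.
rewrite exprD invfM /t; move: (\prod_i _) (\sum_(S in _) _) (q ^- r2) (q ^- r1) => x y u v; ring.
Qed.

Let kappa : {rmorphism A -> {fraction {poly (ratfun n)}}} :=
  GRing.RMorphism.clone _ _ (@const_q (ratfun n) \o @tofrac A) _.

Lemma specialized_generic : specialized kappa (qvar (ratfun n)).
Proof.
apply: specialized_chain; first exact: qvar_neq0.
  by move=> i j /fmorph_inj /tvar_inj.
move=> p k; rewrite /kappa /= -hN KT_coefE rmorph_sum; apply: eq_bigr => w _.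
by rewrite rmorphM chain_series_map.
Qed.

(** The left side of [specialized] multiplied by q^(r1 + r2); as p is at most r2, the subtraction in
    the exponent is exact. *)
Definition lhs_poly : {poly A} :=
  \sum_(p < r2.+1) \sum_(k < (n - r1).+1) (N p k)%:P * 'X^(r1 + (r2 - p) + k).
Definition rhs_poly : {poly A} :=
  (\prod_i (1 + ('X_i)%:P * 'X)) * \sum_(S in pseudo_bases M) (\prod_(i in S) 'X_i)%:P * 'X^#|S|.

Lemma lhs_polyE (K : fieldType) (g : {rmorphism A -> K}) (q : K) : q != 0 ->
  (map_poly g lhs_poly).[q] =
  q ^+ (r1 + r2) * \sum_(p < r2.+1) \sum_(k < (n - r1).+1) g (N p k) * q^-1 ^+ p * q ^+ k.
Proof.
move=> q0; rewrite /lhs_poly rmorph_sum horner_sum mulr_sumr; apply: eq_bigr => p _.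
rewrite rmorph_sum horner_sum mulr_sumr; apply: eq_bigr => k _.
rewrite rmorphM /= map_polyC map_polyXn hornerM hornerC hornerXn /=.
have e : q ^+ (r1 + r2) = q ^+ (r1 + (r2 - p)) * q ^+ p.
  by rewrite -exprD -addnA subnK // -ltnS ltn_ord.
rewrite e exprD exprVn; have := expf_neq0 p q0.
move: (q ^+ p) (q ^+ k) (q ^+ (r1 + _)) (g _) => x y z u x0; by field.
Qed.

Lemma rhs_polyE (K : fieldType) (g : {rmorphism A -> K}) (q : K) :
  (map_poly g rhs_poly).[q] = (\prod_i (1 + g 'X_i * q))
    * \sum_(S in pseudo_bases M) (\prod_(i in S) g 'X_i) * q ^+ #|S|.
Proof.
rewrite /rhs_poly rmorphM hornerM /= map_prod_add1 horner_prod; congr (_ * _).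
  by apply: eq_bigr => i _; rewrite !hornerE.
rewrite rmorph_sum horner_sum; apply: eq_bigr => S _.
by rewrite rmorphM /= map_polyC map_polyXn hornerM hornerC hornerXn /= rmorph_prod.
Qed.

Lemma specializedE (K : fieldType) (g : {rmorphism A -> K}) (q : K) : q != 0 ->
  specialized g q <-> (map_poly g lhs_poly).[q] = (map_poly g rhs_poly).[q].
Proof.
move=> q0; rewrite lhs_polyE // rhs_polyE /specialized; have := expf_neq0 (r1 + r2) q0.
move: (q ^+ _) (\sum_(p < _) _) (\prod_i _) (\sum_(S in _) _) => x a b c x0.
split=> [->|h]; first by rewrite !mulrA mulfV // mul1r.
by rewrite -mulrA -h mulKf.
Qed.

(** At the generic point the passage from polynomials to values is injective, so one instance of
    [specialized] gives the polynomial identity. It then holds for every [g], including evaluation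
    at t = 1, where the chain series have zero denominators. *)
Lemma lhs_rhs_poly : lhs_poly = rhs_poly.
Proof.
have e (p : {poly A}) : (map_poly kappa p).[qvar _] = tofrac (map_poly (@tofrac A) p).
  by rewrite -horner_const_q /kappa map_poly_comp.
have h := proj1 (specializedE _ _ _ qvar_neq0) specialized_generic.
have h' := tofrac_injective _ _ _ (etrans (esym (e lhs_poly)) (etrans h (e rhs_poly))).
exact: (map_inj_poly (tofrac_injective A) (tofrac0 A) h').
Qed.

Lemma specialized_all (K : fieldType) (g : {rmorphism A -> K}) (q : K) : q != 0 ->
  specialized g q.
Proof. by move=> q0; apply/specializedE => //; rewrite lhs_rhs_poly. Qed.

Lemma specialized_one (K : fieldType) (g : {rmorphism A -> K}) (q : K) :
  q != 0 -> (forall i, g 'X_i = 1) ->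
  \sum_(p < r2.+1) \sum_(k < (n - r1).+1) g (N p k) * q^-1 ^+ p * q ^+ k =
  q ^- (r1 + r2) * (1 + q) ^+ n * \sum_(S in pseudo_bases M) q ^+ #|S|.
Proof.
move=> q0 g1; rewrite (specialized_all K g q q0).
have -> : \prod_i (1 + g 'X_i * q) = (1 + q) ^+ n.
  rewrite -[n in RHS]card_ord -prodr_const; apply: eq_bigr => i _.
  by rewrite g1 mul1r.
by congr (_ * _); apply: eq_bigr => S _; rewrite big1 ?mul1r // => i _; exact: g1.
Qed.

Lemma specialized_at1 (K : fieldType) (g : {rmorphism A -> K}) :
  \sum_(p < r2.+1) \sum_(k < (n - r1).+1) g (N p k) * 1^-1 ^+ p * 1 ^+ k =
  \prod_i (1 + g 'X_i) * \sum_(S in pseudo_bases M) \prod_(i in S) g 'X_i.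
Proof.
rewrite (specialized_all K g 1 (oner_neq0 K)) expr1n invr1 mul1r.
by congr (_ * _); apply: eq_bigr => i _; rewrite ?expr1n mulr1.
Qed.

End FieldIdentity.

Section AtOne.
Context {n : nat}.
Local Notation A := {mpoly rat[n]}.

Lemma at_one_tofrac (P : A) : at_one (tofrac P) = P.@[fun=> 1].
Proof.
have h : at_one_spec (tofrac P) (P.@[fun=> 1]).
  by exists P, 1; rewrite meval1 oner_neq0 tofrac1 !divr1.
by apply: (at_one_spec_unique _ h); apply: epsilon_spec; exists (P.@[fun=> 1]).
Qed.

(** [at_one] is a choice function and not a declared morphism, so coefficients are compared one by
    one; for this [at_one 0 = 0] suffices. *)
Lemma map_at_one (p : {poly {poly A}}) :
  map_poly (map_poly (@at_one n)) (map_poly (map_poly (@tofrac A)) p) =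
  map_poly (map_poly (@meval n rat (fun=> 1))) p.
Proof.
have z : at_one (0 : ratfun n) = 0 by rewrite -(tofrac0 A) at_one_tofrac meval0.
have z' : map_poly (@at_one n) 0 = 0.
  by apply/polyP => i; rewrite coef_map_id0 ?coef0.
apply/polyP => i; rewrite (coef_map_id0 _ _ z') !coef_map; apply/polyP => j.
by rewrite (coef_map_id0 _ _ z) !coef_map; exact: at_one_tofrac.
Qed.

End AtOne.

Theorem theorem6p7 (R : realFieldType) (n r1 r2 : nat) (M : flag_matroid n)
    (hr1 : rk (fm1 M) [set: 'I_n] = r1) (hr2 : rk (fm2 M) [set: 'I_n] = r2) :
  [/\ (let q := qvar (ratfun n) in
       eval_q (KT_T R M) (1 + q^-1) (1 + q)
       = q ^- (r1 + r2) * (\prod_(i < n) (1 + const_q (tvar i) * q))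
         * (\sum_(S in pseudo_bases M) const_q (tset S) * q ^+ #|S|)),
      (let q := qvar rat in
       eval_q (KT R M) (1 + q^-1) (1 + q)
       = q ^- (r1 + r2) * (1 + q) ^+ n
         * (\sum_(S in pseudo_bases M) q ^+ #|S|)),
      (KT_T R M).[2, 2]
      = (\prod_(i < n) (1 + tvar i)) * (\sum_(S in pseudo_bases M) tset S)
    & (KT R M).[2, 2] = 2 ^+ n * #|pseudo_bases M|%:R].
Proof.
subst r1 r2.
pose N p k := xchoose (KT_coef_polynomial (R := R) M p k).
have hN p k : KT_coef R M p k = tofrac (N p k) by apply/eqP/(xchooseP (KT_coef_polynomial M p k)).
have eval (K : fieldType) (c : nat -> nat -> K) (x : K) :
    (bipoly (rk (fm2 M) [set: 'I_n]).+1 (n - rk (fm1 M) [set: 'I_n]).+1 c).[1 + x^-1, 1 + x]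
    = \sum_(p < (rk (fm2 M) [set: 'I_n]).+1) \sum_(k < (n - rk (fm1 M) [set: 'I_n]).+1)
        c p k * x^-1 ^+ p * x ^+ k.
  by rewrite horner_bipoly; do 2![apply: eq_bigr => ? _]; rewrite ![1 + _]addrC !addrK.
have eKT_T : KT_T R M = bipoly (rk (fm2 M) [set: 'I_n]).+1 (n - rk (fm1 M) [set: 'I_n]).+1
    (fun p k => tofrac (N p k)).
  by rewrite /KT_T /bipoly; apply: eq_bigr => p _; apply: eq_bigr => k _; rewrite hN.
have eKT : KT R M = bipoly (rk (fm2 M) [set: 'I_n]).+1 (n - rk (fm1 M) [set: 'I_n]).+1
    (fun p k => (N p k).@[fun=> 1]).
  rewrite /KT eKT_T -(map_bipoly _ _ _ _ (@tofrac {mpoly rat[n]})) map_at_one.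
  exact: (map_bipoly _ _ _ _ (@meval n rat (fun=> 1))).
(* Evaluation at 2 is the case q = 1, because 2 = 1 + 1^-1 = 1 + 1; the powers of 1 are kept to
   match [specialized]. *)
have eval1 (K : fieldType) (c : nat -> nat -> K) :
    (bipoly (rk (fm2 M) [set: 'I_n]).+1 (n - rk (fm1 M) [set: 'I_n]).+1 c).[2, 2]
    = \sum_(p < (rk (fm2 M) [set: 'I_n]).+1) \sum_(k < (n - rk (fm1 M) [set: 'I_n]).+1)
        c p k * 1^-1 ^+ p * 1 ^+ k.
  have two : (2 : K) - 1 = 1 by ring.
  by rewrite horner_bipoly two invr1.
split.
- rewrite /= /eval_q eKT_T map_bipoly eval.
  have := specialized_all M N hN _ (@const_q (ratfun n) \o @tofrac {mpoly rat[n]}) _ (qvar_neq0).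
  rewrite /specialized => -> /=; congr (_ * _); apply: eq_bigr => S _.
  by rewrite /tset rmorph_prod.
- rewrite /= /eval_q eKT map_bipoly eval.
  apply: (specialized_one M N hN _ (@const_q rat \o @meval n rat (fun=> 1)) _ (qvar_neq0)) => i.
  by rewrite /= mevalXU rmorph1.
- rewrite eKT_T eval1 (specialized_at1 M N hN _ (@tofrac {mpoly rat[n]})).
  by congr (_ * _); apply: eq_bigr.
- rewrite eKT eval1.
  rewrite (specialized_one M N hN _ (@meval n rat (fun=> 1)) 1 (oner_neq0 _)) => [|i].
    rewrite expr1n invr1 mul1r; congr (_ * _); rewrite -sum1_card natr_sum.
    by apply: eq_bigr => S _; rewrite expr1n.
  exact: mevalXU.
Qed.
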